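(* Let $\widehat{\mathrm{Lie}}_0=\widehat{W}_0=\mathbf{1}_{S_0}$ and $\widehat{\mathrm{Lie}}_1=\widehat W_1=0$. Then for all $n\ge1$, as (virtual) $S_n$-characters, $$\widehat{\mathrm{Lie}}_n=\widehat{\mathrm{Lie}}_{n-1}\big\uparrow_{S_{n-1}}^{S_n}+(-1)^n\epsilon_n,\qquad \widehat W_n=\widehat W_{n-1}\big\uparrow_{S_{n-1}}^{S_n}+(-1)^n\tau_n,$$ where $\epsilon_n$ is the sign character of $S_n$ and $\tau_n$ is the virtual character $\tau_n=\mathbf 1_{S_n}$ for $n\le 3$ and $\tau_n=\chi^{(3,1^{n-3})}-\chi^{(2,2,1^{n-4})}$ for $n\ge4$.
   Context: Let $C_n\subset S_n$ be generated by an $n$-cycle $c$, $\chi_\zeta$ a linear character of $C_n$ sending $c$ to a primitive $n$-th root of unity, and $\mathrm{Lie}_{(n)}=\chi_\zeta\uparrow_{C_n}^{S_n}$. Let $\mathrm{ch}$ be the Frobenius characteristic map from $S_n$-characters to symmetric functions, $\omega$ the involution with $\omega(h_n)=e_n$, and write $f[g]$ for plethysm. Put $\ell_n=\mathrm{ch}(\mathrm{Lie}_{(n)})$ and $\pi_n=\omega(\ell_n)$. For a partition $\lambda=1^{m_1}2^{m_2}\cdots$ of $n$ (with $m_j$ parts equal to $j$) define $S_n$-characters $\mathrm{Lie}_\lambda$, $W_\lambda$ by $\mathrm{ch}(\mathrm{Lie}_\lambda)=\prod_{j\ge1}h_{m_j}[\ell_j]$ and $\mathrm{ch}(W_\lambda)=\prod_{j\text{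 odd}}h_{m_j}[\pi_j]\prod_{j\text{ even}}e_{m_j}[\pi_j]$. The rank of $\lambda$ is $\mathrm{rank}(\lambda)=|\lambda|-\ell(\lambda)$ (number of parts $\ell(\lambda)$). For $n,i\ge0$ let $\widehat{\mathrm{Lie}}^i_n=\bigoplus_\lambda \mathrm{Lie}_\lambda$ and $\widehat W^i_n=\bigoplus_\lambda W_\lambda$, sums over partitions $\lambda$ of $n$ with no parts equal to $1$ and $\mathrm{rank}(\lambda)=i$ (the empty partition of $0$ has rank $0$, and $\mathrm{Lie}_\emptyset=W_\emptyset=\mathbf 1_{S_0}$). Set $\widehat{\mathrm{Lie}}_n=\bigoplus_i\widehat{\mathrm{Lie}}^i_n$, $\widehat W_n=\bigoplus_i\widehat W^i_n$. *)

(* Defs.v *)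
(* Symmetric functions are represented by their coefficients
   in the power-sum basis: f : sf stands for  \sum_lambda f lambda * p_lambda,
   lambda ranging over partitions (nonincreasing seqs of positive integers). *)
From HB Require Import structures.
From mathcomp Require Import all_boot all_order all_algebra all_fingroup
  all_solvable all_field all_character.
Set Implicit Arguments. Unset Strict Implicit. Unset Printing Implicit Defensive.
Import Order.TTheory GRing.Theory Num.Theory.
Local Open Scope ring_scope.

Fixpoint parts_aux (fuel m k : nat) : seq (seq nat) :=
  if m == 0%N then [:: [::]] else
  match fuel with
  | 0 => [::]
  | fuel'.+1 =>
      flatten [seq [seq i :: l | l <- parts_aux fuel' (m - i) i]
              | i <- rev (iota 1 (minn m k))]
  end.
Definition partitions (m : nat) : seq (seq nat) := parts_aux m m m.

Definition zee (l : seq nat) : nat :=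
  \prod_(i <- undup l) (i ^ count_mem i l * (count_mem i l)`!)%N.

Definition sf := seq nat -> algC.
Definition sf_sort (l : seq nat) := sort geq l.
Definition sf_add (f g : sf) : sf := fun l => f l + g l.
Definition sf_scale (c : algC) (f : sf) : sf := fun l => c * f l.
Definition sf_one : sf := fun l => (l == [::])%:R.
Definition sf_p (mu : seq nat) : sf := fun l => (l == sf_sort mu)%:R.
(* product: p_mu * p_nu = p_(mu \cup nu) *)
Definition sf_mul (f g : sf) : sf := fun l =>
  \sum_(pq <- undup [seq (sf_sort (mask (val t) l),
                          sf_sort (mask (map negb (val t)) l))
                    | t <- enum {: (size l).-tuple bool}])
     f pq.1 * g pq.2.
Definition sf_prod (fs : seq sf) : sf := foldr sf_mul sf_one fs.
(* p_k[f] : p_i |-> p_(k i) *)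
Definition sf_pk (k : nat) (f : sf) : sf := fun l =>
  if (0 < k)%N && all (fun x => k %| x)%N l then f [seq (x %/ k)%N | x <- l]
  else 0.
Definition sf_omega (f : sf) : sf := fun l =>
  (-1) ^+ (sumn l - size l) * f l.
Definition sf_h (m : nat) : sf := fun l =>
  \sum_(mu <- partitions m) (zee mu)%:R^-1 * sf_p mu l.
Definition pleth_h (m : nat) (g : sf) : sf := fun l =>
  \sum_(mu <- partitions m)
     (zee mu)%:R^-1 * sf_prod [seq sf_pk i g | i <- mu] l.
Definition pleth_e (m : nat) (g : sf) : sf := fun l =>
  \sum_(mu <- partitions m)
     (-1) ^+ (m - size mu) * (zee mu)%:R^-1 * sf_prod [seq sf_pk i g | i <- mu] l.

(* Jacobi-Trudi: s_lambda = det (h_(lambda_i - i + j)) *)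
Definition sf_det (k : nat) (M : 'I_k -> 'I_k -> sf) : sf := fun l =>
  \sum_(s : 'S_k) (-1) ^+ odd_perm s * sf_prod [seq M i (s i) | i <- enum 'I_k] l.
Definition schur (lam : seq nat) : sf :=
  sf_det (fun i j : 'I_(size lam) =>
    if (nth 0 lam i + j < i)%N then (fun _ => 0)
    else sf_h (nth 0 lam i + j - i)).

Definition cycle_type n (s : 'S_n) : seq nat :=
  sf_sort (map (fun X : {set 'I_n} => #|X|) (enum (porbits s))).

Definition cf_of_fun (gT : finGroupType) (G : {group gT}) (f : gT -> algC)
  : 'CF(G) := \sum_(C in classes G) f (repr C) *: '1_C.

Definition ch n (chi : 'CF([set: 'S_n])) : sf := fun l =>
  (n`!)%:R^-1 * \sum_(s : 'S_n | cycle_type s == l) chi s.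
Definition chinv n (F : sf) : 'CF([set: 'S_n]) :=
  cf_of_fun [set: 'S_n]%G
    (fun s => (zee (cycle_type s))%:R * F (cycle_type s)).

Definition sign_cf n : 'CF([set: 'S_n]) :=
  cf_of_fun [set: 'S_n]%G (fun s => (-1) ^+ odd_perm s).

Definition chi_part n (lam : seq nat) : 'CF([set: 'S_n]) := chinv n (schur lam).

Definition ncycle n : 'S_n := perm (@ordS_inj n).
Definition chi_zeta n : 'CF(<[ncycle n]>) :=
  match [pick i : Iirr <[ncycle n]> | n.-primitive_root ('chi_i (ncycle n))] with
  | Some i => 'chi_i
  | None => 0
  end.
Definition Lie_n n : 'CF([set: 'S_n]) := 'Ind[[set: 'S_n]] (chi_zeta n).
Definition ell n : sf := ch (Lie_n n).
Definition piS n : sf := sf_omega (ell n).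

Definition LieSF (lam : seq nat) : sf :=
  sf_prod [seq pleth_h (count_mem j lam) (ell j) | j <- undup lam].
Definition WSF (lam : seq nat) : sf :=
  sf_prod [seq (if odd j then pleth_h (count_mem j lam) (piS j)
                else pleth_e (count_mem j lam) (piS j)) | j <- undup lam].

Definition rank_part (lam : seq nat) : nat := (sumn lam - size lam)%N.

Definition LieHat_i n i : 'CF([set: 'S_n]) :=
  \sum_(lam <- partitions n | (1%N \notin lam) && (rank_part lam == i))
    chinv n (LieSF lam).
Definition WHat_i n i : 'CF([set: 'S_n]) :=
  \sum_(lam <- partitions n | (1%N \notin lam) && (rank_part lam == i))
    chinv n (WSF lam).
(* rank(lambda) <= n, so summing i over 0..n gives the full direct sum *)
Definition LieHat n : 'CF([set: 'S_n]) := \sum_(i < n.+1) LieHat_i n i.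
Definition WHat n : 'CF([set: 'S_n]) := \sum_(i < n.+1) WHat_i n i.

Definition Stab m : {group 'S_m.+1} := 'C[ord_max | 'P]%G.
(* transport of a class function of S_m along lift_perm : S_m ~= Stab m *)
Definition cf_lift m (phi : 'CF([set: 'S_m])) : 'CF(Stab m) :=
  cf_of_fun (Stab m) (fun s =>
    match [pick t : 'S_m | lift_perm ord_max ord_max t == s] with
    | Some t => phi t
    | None => 0
    end).

Definition tau n : 'CF([set: 'S_n]) :=
  if (n <= 3)%N then 1
  else chi_part n (3%N :: nseq (n - 3) 1%N) - chi_part n ([:: 2; 2]%N ++ nseq (n - 4) 1%N).

(* Main.v *)
(* Encode a symmetric function by its power-sum expansion in {mpoly algC[N]},
   'X_i standing for p_(i+1); this is faithful on partitions with parts at most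
   N.  A sequence A of ring elements "is" a formal series with A_0 = 1 and is
   pinned down, in characteristic 0, by the coefficients q_r of its logarithmic
   derivative: m A_m = sum_(1 <= r <= m) q_r A_(m-r).  These coefficients add up
   when series are multiplied, and those of sum_lambda prod_j a_j(m_j(lambda))
   are computed from those of the a_j.  Since ell_n = 1/n sum_(d | n) mu(d)
   p_d^(n/d), where mu(d) is the sum of the primitive d-th roots of unity, the
   identities sum_(d | n) mu(d) = [n = 1] and
   sum_(d | n) (-1)^(n/d) mu(d) = - [n = 1] + 2 [n = 2] give
     sum_n ch LieHat_n = E(-1) / (1 - p_1),
     sum_n ch WHat_n = (1 + p_2) E(-1) / (1 - p_1),   E(-1) = sum_n (-1)^n e_n.
   Multiplying by 1 - p_1 yields the recurrences, because inducing from S_(n-1)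
   to S_n is multiplication by p_1, and because the Jacobi-Trudi determinants give
   s_(3,1^(n-3)) - s_(2,2,1^(n-4)) = e_n + p_2 e_(n-2). *)
Require Import Defs.
From HB Require Import structures.
From mathcomp Require Import all_boot all_order all_algebra all_fingroup
  all_solvable all_field all_character.
From mathcomp Require Import mpoly ring.
Import GRing.Theory Num.Theory.
Local Open Scope ring_scope.
Set Implicit Arguments. Unset Strict Implicit. Unset Printing Implicit Defensive.

(** * Series given by their logarithmic derivative *)

(* A is the series with logarithmic derivative sum_(r > 0) q_r t^(r-1). *)
Definition newton (R : nzRingType) (q A : nat -> R) : Prop :=
  A 0%N = 1 /\
  forall m, A m *+ m = \sum_(i < m) q i.+1 * A (m - i.+1)%N.

Definition conv (R : nzRingType) (A B : nat -> R) (n : nat) : R :=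
  \sum_(i < n.+1) A i * B (n - i)%N.

(** The relation at [m] expresses [m A_m] through earlier terms, and the factor [m] cancels in
    characteristic zero. *)
Lemma newton_uniq (F : numFieldType) (R : algType F) (q q' A B : nat -> R) :
  (forall r, (0 < r)%N -> q r = q' r) -> newton q A -> newton q' B -> A =1 B.
Proof.
move=> eqq [A0 An] [B0 Bn] m.
elim/ltn_ind: m => -[|m] IH; first by rewrite A0 B0.
have : A m.+1 *+ m.+1 = B m.+1 *+ m.+1.
  rewrite An Bn; apply: eq_bigr => i _; rewrite eqq // IH //.
  by rewrite subSS ltnS leq_subr.
rewrite -!scaler_nat; apply: scalerI; exact: (@Num.Theory.lt0r_neq0).
Qed.

Lemma eq_newton (R : nzRingType) (q q' A B : nat -> R) :
  (forall r, (0 < r)%N -> q r = q' r) -> A =1 B -> newton q A -> newton q' B.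
Proof.
move=> eqq eqA [A0 An]; split=> [|m]; rewrite -eqA // An.
by apply: eq_bigr => i _; rewrite eqq // eqA.
Qed.

Lemma coefM_eql (R : nzRingType) (p p' s : {poly R}) m :
  (forall i, (i <= m)%N -> p`_i = p'`_i) -> (p * s)`_m = (p' * s)`_m.
Proof. by move=> e; rewrite !coefM; apply: eq_bigr => i _; rewrite e // -ltnS. Qed.

(** Leibniz rule: [(AB)'/AB = A'/A + B'/B]. The coefficient at [m] sees only degrees up to [m], so
    the series are truncated to polynomials, where [derivM] applies. *)
Lemma newton_conv (R : comNzRingType) (q q' A B : nat -> R) :
  newton q A -> newton q' B -> newton (fun r => q r + q' r) (conv A B).
Proof.
move=> [A0 An] [B0 Bn]; split=> [|m]; first by rewrite /conv big_ord1 A0 B0 mulr1.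
pose tr (C : nat -> R) := \poly_(i < m.+1) C i.
(* Clearing the constant term makes the product start at [q 1], as the sum in [newton] does. *)
pose tr0 (C : nat -> R) := tr (fun i => if i == 0%N then 0 else C i).
have trE C i : (i <= m)%N -> (tr C)`_i = C i by move=> le; rewrite coef_poly ltnS le.
have trM C D i : (i <= m)%N -> (tr C * tr D)`_i = conv C D i.
  move=> le; rewrite coefM; apply: eq_bigr => j _; rewrite !trE //.
    by rewrite (leq_trans (leq_subr _ _)).
  by rewrite (leq_trans _ le) // -ltnS.
have tr0M r (P : {poly R}) i : (i <= m)%N ->
    (tr0 r * P)`_i = \sum_(j < i) r j.+1 * P`_(i - j.+1).
  move=> le; rewrite coefM big_ord_recl /= trE // mul0r add0r.
  apply: eq_bigr => j _; rewrite trE //=.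
  by apply: leq_trans le.
(* The Newton relation as a polynomial identity [t C' = r C], valid up to degree [m] because of the
   truncation. *)
have key r C : (forall i, C i *+ i = \sum_(j < i) r j.+1 * C (i - j.+1)%N) ->
    forall i, (i <= m)%N -> ('X * (tr C)^`())`_i = (tr0 r * tr C)`_i.
  move=> Cn i le; rewrite tr0M // coefXM coef_deriv; case: i le => [|i] le.
    by rewrite big_ord0.
  rewrite /= trE // Cn; apply: eq_bigr => j _; rewrite trE //.
  by rewrite (leq_trans (leq_subr _ _)).
transitivity (('X * (tr A * tr B)^`())`_m).
  rewrite coefXM coef_deriv; case: (m) trM => [|m'] trM; first by rewrite mulr0n.
  by rewrite trM.
have -> : 'X * (tr A * tr B)^`() =
   ('X * (tr A)^`()) * tr B + ('X * (tr B)^`()) * tr A.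
  by rewrite derivM mulrDr !mulrA; congr (_ + _); rewrite mulrAC.
rewrite coefD (coefM_eql _ (key q A An)) (coefM_eql _ (key q' B Bn)).
rewrite -!mulrA (mulrC (tr B)) !tr0M // -big_split; apply: eq_bigr => j _ /=.
by rewrite trM ?leq_subr // mulrDl.
Qed.

(* The coefficients of A(t^j). *)
Definition stretch (R : nzRingType) j (a : nat -> R) n : R :=
  if (j %| n)%N then a (n %/ j)%N else 0.

(** Substituting [t^j] for [t] commutes with [t d/dt] up to a factor [j], the source of [*+ j]. *)
Lemma newton_stretch (R : nzRingType) j (b a : nat -> R) : (0 < j)%N ->
  newton b a -> newton (stretch j (fun i => b i *+ j)) (stretch j a).
Proof.
case: j => // j _ [a0 an]; split=> [|m]; first by rewrite /stretch dvdn0 div0n.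
case: (boolP (j.+1 %| m)%N) => [/dvdnP[n ->]|ndv]; last first.
  rewrite {1}/stretch (negPf ndv) mul0rn big1 // => i _.
  rewrite /stretch; case: ifP => [d1|]; last by rewrite mul0r.
  case: ifP => [d2|]; last by rewrite mulr0.
  by rewrite -(subnK (ltn_ord i)) dvdn_addl ?d2 in ndv.
have stretchM f i : stretch j.+1 f (i * j.+1)%N = f i :> R.
  by rewrite /stretch dvdn_mull // mulnK.
rewrite stretchM mulrnA an -sumrMnl.
(* Among the indices of the long sum only the [n] multiples of [j.+1] contribute. *)
have {an} E (f : nat -> R) : (forall i, ~~ (j.+1 %| i)%N -> f i = 0) ->
    \sum_(i < n * j.+1) f i.+1 = \sum_(i < n) f (i.+1 * j.+1)%N.
  move=> f0; elim: n => [|n IH]; first by rewrite mul0n !big_ord0.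
  rewrite [RHS]big_ord_recr -IH mulSn addnC.
  rewrite big_split_ord /=; congr (_ + _).
  rewrite big_ord_recr /= big1 ?add0r => [|i _].
    by rewrite -addnS addnC -mulSn.
  apply: f0; rewrite -addnS dvdn_addr ?dvdn_mull //.
  by rewrite gtnNdvd // ltnS.
rewrite (E (fun i => stretch j.+1 (fun i => b i *+ j.+1) i * stretch j.+1 a (n * j.+1 - i)%N)).
  by apply: eq_bigr => i _; rewrite stretchM -mulnBl stretchM mulrnAl.
by move=> i /negPf nd; rewrite {1}/stretch nd mul0r.
Qed.

(** * Enumerating partitions by largest part *)

Lemma parts_aux_fuel f f' m k : (m <= f)%N -> (m <= f')%N ->
  parts_aux f m k = parts_aux f' m k.
Proof.
elim: f f' m k => [|f IH] [|f'] [|m] k //= le1 le2.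
congr flatten; apply/eq_in_map => i; rewrite mem_rev mem_iota => /andP[i1 _].
by rewrite (IH f') // leq_subLR; [apply: leq_trans le1 _|apply: leq_trans le2 _];
  rewrite -addn1 addnC leq_add2r.
Qed.

(* Lists the partitions of m with parts at most k. *)
Definition bparts m k := parts_aux m m k.

Lemma bparts0 k : bparts 0 k = [:: [::]]. Proof. by []. Qed.

(** Splits by whether the part [k.+1] occurs; the lists containing it come first because the
    enumeration goes by decreasing largest part. *)
Lemma bparts_rec m k : (0 < m)%N ->
  bparts m k.+1 = (if (k < m)%N then [seq k.+1 :: l | l <- bparts (m - k.+1) k.+1]
                   else [::]) ++ bparts m k.
Proof.
case: m => // m _; rewrite /bparts /=.
case: ltnP => km; last by rewrite (minn_idPl (leqW km)).
have E : iota 1 k.+1 = rcons (iota 1 k) k.+1 by rewrite -{1}[k.+1]addn1 iotaD cats1.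
rewrite (minn_idPr km) E rev_rcons /=.
congr (_ ++ _); congr map; apply: parts_aux_fuel => //.
by rewrite leq_subLR addSn ltnS leq_addl.
Qed.

Lemma bparts_big m k : (m <= k)%N -> bparts m k = bparts m m.
Proof. by rewrite /bparts; case: m => // m le; rewrite /= minnn (minn_idPl le). Qed.

Lemma bpartsP m k l : l \in bparts m k ->
  [/\ all (fun i => 0 < i <= k)%N l, sumn l = m & sorted geq l].
Proof.
elim: k m l => [|k IHk] m; first by case: m => [|m] l; rewrite ?inE // => /eqP->.
elim/ltn_ind: m => -[|m] IHm l; first by rewrite bparts0 inE => /eqP->.
rewrite bparts_rec // mem_cat => /orP[].
  case: ltnP => // km /mapP[l' l'in ->].
  have [|al sl sol] := IHm _ _ _ l'in; first by rewrite subSS ltnS leq_subr.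
  rewrite /= leqnn sl subnKC // al; split=> //.
  by rewrite path_min_sorted //; apply: sub_all al => i /andP[].
move=> /IHk[al sl sol]; split=> //.
by apply: sub_all al => i /andP[-> /leqW].
Qed.

(** The range is all of 1, ..., k instead of the distinct parts of [l], so that admitting the part
    size [k.+1] multiplies the weight by exactly one factor. *)
Definition wt (R : nzRingType) (a : nat -> nat -> R) k (l : seq nat) : R :=
  \prod_(j < k) a j.+1 (count_mem j.+1 l).

Lemma wt_undup (R : comNzRingType) (a : nat -> nat -> R) k l :
  (forall j, a j 0%N = 1) -> all (fun i => 0 < i <= k)%N l ->
  \prod_(j <- undup l) a j (count_mem j l) = wt a k l.
Proof.
move=> a0 al; rewrite /wt -(big_mkord xpredT (fun j => a j.+1 (count_mem j.+1 l))).
rewrite -(big_add1 _ _ 0 k.+1 xpredT (fun j => a j (count_mem j l))).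
rewrite [RHS](bigID (fun j => j \in l)) /= [X in _ * X]big1 ?mulr1; last first.
  by move=> j /count_memPn ->; rewrite a0.
rewrite -[RHS]big_filter; apply: perm_big; apply: uniq_perm; rewrite ?undup_uniq //.
  by apply/filter_uniq; apply: iota_uniq.
move=> j; rewrite mem_undup mem_filter mem_index_iota.
by case jl: (j \in l) => //; rewrite (allP al).
Qed.

Lemma count_bparts_gt m k l j : l \in bparts m k -> (k < j)%N -> count_mem j l = 0%N.
Proof.
move=> /bpartsP[al _ _] kj; apply/count_memPn/negP => jl.
by have /andP[_] := allP al _ jl; rewrite leqNgt kj.
Qed.

(** Below degree [k.+1] the stretched series has only its constant term; the other terms are shifted
    down by [k.+1]. This mirrors [bparts_rec]. *)
Lemma conv_stretch_rec (R : nzRingType) (a T : nat -> R) k m :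
  conv (stretch k.+1 a) T m =
  a 0%N * T m + (if (k < m)%N then conv (stretch k.+1 (fun i => a i.+1)) T (m - k.+1)%N else 0).
Proof.
have E n : (n <= m)%N -> (n <= k)%N -> \sum_(i < n.+1) stretch k.+1 a i * T (m - i)%N = a 0%N * T m.
  move=> nm nk; rewrite big_ord_recl /= subn0 {1}/stretch dvdn0 div0n big1 ?addr0 // => i _.
  rewrite /stretch gtnNdvd ?mul0r //= ltnS; apply: leq_trans nk.
  by rewrite /bump /= add1n.
rewrite /conv; case: ltnP => km; last by rewrite E // addr0.
rewrite -(E k) ?(ltnW km) //.
rewrite -(big_mkord xpredT (fun i => stretch k.+1 a i * T (m - i)%N)).
rewrite (@big_cat_nat _ _ _ k.+1) //=; last by rewrite ltnS ltnW.
rewrite big_mkord; congr (_ + _).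
rewrite -{1}[k.+1]add0n big_addn big_mkord subSn //.
apply: eq_bigr => i _; rewrite addnC subnDA; congr (_ * _).
by rewrite /stretch dvdn_addr // divnDl // divnn /= add1n.
Qed.

(** * Multiplicative weights summed over partitions *)

Section PartitionSum.
Variables (R : comNzRingType) (a b : nat -> nat -> R).
Hypothesis newton_ab : forall j, (0 < j)%N -> newton (b j) (a j).

Let T k m := \sum_(l <- bparts m k) wt a k l.

(** [c] counts the copies of [k.+1] already taken off; letting it vary makes the induction along
    [bparts_rec] work. At [c = 0] the left side is [T k.+1]. *)
Lemma bparts_sum_shift k c m :
  \sum_(l <- bparts m k.+1) wt a k l * a k.+1 (c + count_mem k.+1 l)%N =
  conv (stretch k.+1 (fun i => a k.+1 (c + i)%N)) (T k) m.
Proof.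
elim/ltn_ind: m c => m IH c; rewrite conv_stretch_rec addn0.
case: m IH => [|m] IH; first by rewrite /T bparts0 !big_seq1 addr0 addn0 mulrC.
rewrite bparts_rec // big_cat /= addrC; congr (_ + _).
  rewrite /T mulr_sumr !big_seq; apply: eq_bigr => l lin.
  by rewrite (count_bparts_gt lin) // addn0 mulrC.
case: ifP => km; last by rewrite big_nil.
rewrite big_map.
have -> : \sum_(j <- bparts (m.+1 - k.+1) k.+1)
    wt a k (k.+1 :: j) * a k.+1 (c + count_mem k.+1 (k.+1 :: j))%N =
  \sum_(j <- bparts (m.+1 - k.+1) k.+1)
    wt a k j * a k.+1 (c.+1 + count_mem k.+1 j)%N.
  apply: eq_bigr => j _; rewrite /= eqxx addnA addn1; congr (_ * _).
  by apply: eq_bigr => i _; rewrite /= eqSS gtn_eqF.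
rewrite IH; last by rewrite subSS ltnS leq_subr.
apply: eq_bigr => i _; congr (_ * _); rewrite /stretch; case: ifP => // _.
by rewrite addSnnS.
Qed.

Lemma newton_bparts k :
  newton (fun r => \sum_(j < k) stretch j.+1 (fun i => b j.+1 i *+ j.+1) r) (T k).
Proof.
elim: k => [|k IH].
  split=> [|m]; first by rewrite /T bparts0 big_seq1 /wt big_ord0.
  rewrite big1 => [|i _]; last by rewrite big_ord0 mul0r.
  case: m => // m; rewrite /T.
  have -> : bparts m.+1 0 = [::] by [].
  by rewrite big_nil mul0rn.
have := newton_conv (newton_stretch (ltn0Sn k) (newton_ab (ltn0Sn k))) IH.
apply: eq_newton => [r _|m]; first by rewrite big_ord_recr /= addrC.
rewrite -(bparts_sum_shift k 0); apply: eq_bigr => l _.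
by rewrite /wt big_ord_recr.
Qed.

(** The generating function is the infinite product of the [a_j(t^j)]; at index [r] only the
    divisors [j] of [r] contribute. *)
Lemma newton_partitions :
  newton (fun r => \sum_(j <- divisors r) b j (r %/ j)%N *+ j)
         (fun m => \sum_(l <- partitions m) \prod_(j <- undup l) a j (count_mem j l)).
Proof.
(* [newton_ab] covers positive [j], while [wt_undup] wants [a j 0 = 1] for every [j]; [a'] patches
   the index 0. *)
pose a' j := if j is 0%N then fun=> 1 else a j.
have a'0 j : a' j 0%N = 1 by case: j => // j; case: (newton_ab (ltn0Sn j)).
have TE k m : (m <= k)%N ->
  \sum_(l <- partitions m) \prod_(j <- undup l) a j (count_mem j l) = T k m.
  move=> mk; rewrite /T (bparts_big mk) !big_seq; apply: eq_bigr => l lin.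
  have [al _ _] := bpartsP lin.
  have {}al : all (fun i => 0 < i <= k)%N l.
    by apply: sub_all al => i /andP[-> /leq_trans ->].
  have -> : wt a k l = wt a' k l by apply: eq_bigr.
  rewrite -wt_undup // !big_seq; apply: eq_bigr => j; rewrite mem_undup => /(allP al).
  by case: j.
split=> [|m]; first by rewrite big_seq1 big_nil.
have [_ Tm] := newton_bparts m; rewrite (TE m) // Tm; apply: eq_bigr => i _.
rewrite (TE m) ?leq_subr //; congr (_ * _).
rewrite -(big_mkord xpredT (fun j => stretch j.+1 (fun n => b j.+1 n *+ j.+1) i.+1)).
rewrite -(big_add1 _ _ 0 m.+1 xpredT (fun j => stretch j (fun n => b j n *+ j) i.+1)).
rewrite -big_mkcond -big_filter; apply: perm_big; apply: uniq_perm.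
- by apply/filter_uniq; apply: iota_uniq.
- exact: divisors_uniq.
move=> j; rewrite mem_filter mem_index_iota -dvdn_divisors // andbC.
case: (boolP (j %| i.+1)%N) => [dv|_]; last by rewrite andbF.
by rewrite andbT (dvdn_gt0 _ dv) //= ltnS (leq_trans (dvdn_leq _ dv)).
Qed.
End PartitionSum.

(** * Geometric, linear and exponential series *)

Lemma mulrSnI (F : numFieldType) (V : lmodType F) n : injective (fun x : V => x *+ n.+1).
Proof.
move=> x y /=; rewrite -!scaler_nat; apply: scalerI; exact: (@Num.Theory.lt0r_neq0).
Qed.

Lemma newton_geom (R : nzRingType) (x : R) : newton (fun r => x ^+ r) (fun n => x ^+ n).
Proof.
split=> // m; rewrite (eq_bigr (fun=> x ^+ m)) ?sumr_const ?card_ord // => i _.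
by rewrite -exprD subnKC.
Qed.

Lemma newton_sign (R : comNzRingType) (q A : nat -> R) : newton q A ->
  newton (fun r => (-1) ^+ r * q r) (fun n => (-1) ^+ n * A n).
Proof.
move=> [A0 An]; split=> [|m]; first by rewrite mul1r.
rewrite -mulrnAr An mulr_sumr; apply: eq_bigr => i _.
by rewrite mulrACA -exprD subnKC.
Qed.

(** The series [1 + x t]; stretched by 2 at [x = p_2] it becomes the factor [1 + p_2] of the W
    series. *)
Lemma newton_1Dx (R : comNzRingType) (x : R) :
  newton (fun r => - (- x) ^+ r)
    (fun n => match n with 0 => 1 | 1 => x | _ => 0 end).
Proof.
split=> // -[|[|m]]; rewrite ?big_ord0 //.
  by rewrite big_ord1 /= mulr1 opprK.
rewrite mul0rn !big_ord_recr /= big1 ?add0r => [|i _].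
  by rewrite subnn subSS subSn // subnn mulr1 [in X in _ + X]exprS; ring.
rewrite !subSS; have := ltn_ord i; rewrite -subn_gt0.
by case E : (m - i)%N => [|k] // _; rewrite subSn ?E ?mulr0 // ltnW.
Qed.

(** Coefficient form of multiplying back by [1 - x t]; at [x = p_1] this is the shape of the
    recurrences. *)
Lemma conv_geom_rec (R : comNzRingType) (x : R) (C : nat -> R) n :
  conv C (fun i => x ^+ i) n.+1 = x * conv C (fun i => x ^+ i) n + C n.+1.
Proof.
rewrite /conv big_ord_recr /= subnn mulr1 mulr_sumr; congr (_ + _).
by apply: eq_bigr => i _; rewrite subSn -1?ltnS // exprS mulrCA.
Qed.

Section ExpSum.
Variables (F : numFieldType) (R : comAlgType F).

(* The degree n term of exp (sum_j x_j t^j / j): this is h_n[g] for x_j = p_j[g]. *)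
Definition expsum (x : nat -> R) n : R :=
  \sum_(l <- partitions n)
    \prod_(j <- undup l) (((j ^ count_mem j l * (count_mem j l)`!)%N)%:R^-1
                            *: x j ^+ count_mem j l).

(** The series is [exp(x t / j)], whose logarithmic derivative is the constant [x / j]. *)
Lemma newton_exp (x : R) j : (0 < j)%N ->
  newton (fun r => if r == 1%N then j%:R^-1 *: x else 0)
         (fun i => ((j ^ i * i`!)%N)%:R^-1 *: x ^+ i).
Proof.
move=> j0; split=> [|[|m]]; first by rewrite expn0 mul1n invr1 scale1r.
  by rewrite mulr0n big_ord0.
rewrite big_ord_recl big1 => [|i _]; last by rewrite mul0r.
rewrite addr0 subn1 /= -scalerAr -scalerAl scalerA -exprS -scaler_nat scalerA.
congr (_ *: _); rewrite factS expnS !natrM.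
have nz n : (0 < n)%N -> n%:R != 0 :> F by rewrite Num.Theory.pnatr_eq0 -lt0n.
by field; rewrite !nz ?fact_gt0 ?expn_gt0 ?j0 //= -(natrD _ 1) nz.
Qed.

(** In [newton_partitions] the factor for [j] contributes at [r] only when [r / j = 1], and then the
    contribution is [r (x_r / r)]. *)
Lemma newton_expsum (x : nat -> R) : newton x (expsum x).
Proof.
have := newton_partitions (fun j j0 => newton_exp (x j) j0).
apply: eq_newton => // r r0; rewrite (bigD1_seq r) ?divisors_uniq ?divisors_id //=.
rewrite divnn r0 eqxx -scaler_nat scalerA mulfV ?scale1r ?Num.Theory.pnatr_eq0 -?lt0n //.
rewrite big1_seq ?addr0 // => j /andP[/eqP jr]; rewrite -dvdn_divisors // => dv.
case: eqP => [e|]; last by rewrite mul0rn.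
by case: jr; rewrite -(divnK dv) e mul1n.
Qed.
End ExpSum.

(** With [d] summed outermost, both inner sums run over the multiples of [d] dividing [n], and
    [j |-> d * (n / j)] is an involution of that set. *)
Lemma sum_divisors_reindex (V : nmodType) n (f : nat -> nat -> V) : (0 < n)%N ->
  \sum_(j <- divisors n) \sum_(d <- divisors j) f d j =
  \sum_(N <- divisors n) \sum_(d <- divisors N) f d (d * (n %/ N))%N.
Proof.
move=> n0.
have E (g : nat -> nat -> V) :
    \sum_(j <- divisors n) \sum_(d <- divisors j) g d j =
    \sum_(d <- divisors n) \sum_(j <- divisors n | (d %| j)%N) g d j.
  rewrite [RHS](exchange_big_dep xpredT) //= big_seq [RHS]big_seq.
  apply: eq_bigr => j; rewrite -dvdn_divisors // => jn.
  rewrite -[RHS]big_filter; apply: perm_big; apply: uniq_perm.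
  - exact: divisors_uniq.
  - by rewrite filter_uniq ?divisors_uniq.
  move=> d; rewrite mem_filter -!dvdn_divisors ?(dvdn_gt0 n0) //.
  by case: (boolP (d %| j)%N) => // dj; rewrite (dvdn_trans dj).
rewrite !E big_seq [RHS]big_seq; apply: eq_bigr => d; rewrite -dvdn_divisors // => dn.
rewrite -[LHS]big_filter -[RHS]big_filter -[RHS](big_map (fun N => d * (n %/ N))%N xpredT (f d)).
set s := [seq i <- divisors n | (d %| i)%N].
have sP j : (j \in s) = (d %| j)%N && (j %| n)%N.
  by rewrite mem_filter -dvdn_divisors.
have d0 := dvdn_gt0 n0 dn.
have uniq_s : uniq s by rewrite filter_uniq ?divisors_uniq.
have inv j : j \in s -> (d * (n %/ (d * (n %/ j))))%N = j.
  rewrite sP => /andP[/dvdnP[j' ->] /dvdnP[k ek]]; move: n0.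
  rewrite {}ek !muln_gt0 => /andP[k0 /andP[j'0 _]].
  rewrite mulnK ?muln_gt0 ?j'0 // (mulnC d k) [(k * _)%N]mulnC -mulnA [(d * k)%N]mulnC.
  by rewrite mulnK ?muln_gt0 ?k0 // mulnC.
have stab j : j \in s -> (d * (n %/ j))%N \in s.
  rewrite !sP => /andP[dj jn]; rewrite dvdn_mulr //= -{2}(divnK jn) mulnC.
  by rewrite dvdn_mul.
apply: perm_big; apply: uniq_perm => //.
  by rewrite map_inj_in_uniq // => i j /inv {2}<- /inv {2}<- /= ->.
move=> j; apply/idP/mapP => [js|[i is_ ->]]; last exact: stab.
by exists (d * (n %/ j))%N; rewrite ?inv ?stab.
Qed.

(** * The logarithmic derivatives of the Lie and Whitney series *)

(** [(-1)^(n/d)] is [-1], plus 2 when [n/d] is even, and the divisors [d] with [n/d] even are the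
    divisors of [n/2]. *)
Lemma mobius_alternating (R : pzRingType) (mob : nat -> R) :
  (forall n, (0 < n)%N -> \sum_(d <- divisors n) mob d = (n == 1%N)%:R) ->
  forall n, (0 < n)%N ->
  \sum_(d <- divisors n) (-1) ^+ (n %/ d) * mob d = - (n == 1%N)%:R + (n == 2%N)%:R *+ 2.
Proof.
move=> mobP n n0.
have E d : (-1) ^+ (n %/ d) * mob d = - mob d + (if ~~ odd (n %/ d) then mob d else 0) *+ 2.
  rewrite -signr_odd; case: (odd _) => /=; first by rewrite mul0rn addr0 mulN1r.
  by rewrite mul1r mulr2n addrA addNr add0r.
rewrite (eq_bigr _ (fun d _ => E d)) big_split /= sumrN mobP // sumrMnl; congr (_ + _ *+ 2).
rewrite -big_mkcond; case: (boolP (odd n)) => on.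
  rewrite big1_seq; first by case: eqP on => // ->.
  move=> d /andP[od]; rewrite -dvdn_divisors // => dn.
  by move: on; rewrite -(divnK dn) oddM (negPf od).
have n2 : n = (n./2 * 2)%N by rewrite muln2 even_halfK.
have h0 : (0 < n./2)%N by case: (n./2) n2 n0 => // ->.
transitivity (\sum_(d <- divisors n./2) mob d); last first.
  by rewrite mobP // [in RHS]n2 -[2%N in RHS]mul1n eqn_pmul2r.
rewrite -big_filter; apply: perm_big; apply: uniq_perm.
- by rewrite filter_uniq ?divisors_uniq.
- exact: divisors_uniq.
move=> d; rewrite mem_filter -!dvdn_divisors // -dvdn2.
apply/andP/idP => [[ev dn]|dn].
  by move: ev; rewrite dvdn_divRL // mulnC {1}n2 dvdn_pmul2r.
have dn' : (d %| n)%N by rewrite n2 dvdn_mulr.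
by split=> //; rewrite dvdn_divRL // mulnC {1}n2 dvdn_pmul2r.
Qed.

Section LieIdentities.
Variables (F : numFieldType) (R : comAlgType F) (p : nat -> R) (mob : nat -> F).
Hypothesis mobP : forall n, (0 < n)%N -> \sum_(d <- divisors n) mob d = (n == 1%N)%:R.

(* p_r[ell_j]. *)
Definition pk_ell j r : R :=
  j%:R^-1 *: \sum_(d <- divisors j) mob d *: p (r * d)%N ^+ (j %/ d).

(* p_r[pi_j]. *)
Definition pk_piS j r : R :=
  j%:R^-1 *: \sum_(d <- divisors j)
    (-1) ^+ (j - j %/ d) * mob d *: p (r * d)%N ^+ (j %/ d).

(** The elementary symmetric functions: [omega] sends [p_r] to [(-1)^(r-1) p_r] and [h_n] to
    [e_n]. *)
Definition eseq := expsum (fun r => (-1) ^+ r.-1 * p r).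

Lemma newton_eseq_sign : newton (fun r => - p r) (fun n => (-1) ^+ n * eseq n).
Proof.
apply: eq_newton (newton_sign (newton_expsum _)) => // -[|r] // _.
by rewrite exprS mulN1r mulrA mulNr -expr2 sqrr_sign mulN1r.
Qed.

Definition no_ones (b : nat -> nat -> R) j : nat -> R :=
  if j == 1%N then (fun=> 0) else b j.

(** Giving the part size 1 the weight [[m = 0]] kills every partition containing 1, so just the term
    [j = 1] leaves the divisor sum. *)
Lemma newton_no_ones (b a : nat -> nat -> R) :
  (forall j, (1 < j)%N -> newton (b j) (a j)) ->
  newton (fun r => \sum_(j <- divisors r) b j (r %/ j)%N *+ j - b 1%N r)
    (fun n => \sum_(l <- partitions n | 1%N \notin l)
       \prod_(j <- undup l) a j (count_mem j l)).
Proof.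
move=> ab.
pose a' j := if j == 1%N then (fun n => (n == 0%N)%:R) else a j.
have nab j : (0 < j)%N -> newton (no_ones b j) (a' j).
  rewrite /no_ones /a' => j0; case: eqVneq => [_|j1].
    split=> // -[|m]; first by rewrite big_ord0.
    by rewrite big1 ?mul0rn // => i _; rewrite mul0r.
  by apply: ab; case: j j0 j1 => [|[|]].
apply: eq_newton (newton_partitions nab) => [r r0|n].
  rewrite [in RHS](bigD1_seq 1%N) ?divisors_uniq -?dvdn_divisors ?dvd1n //=.
  rewrite divn1 mulr1n addrAC subrr add0r (bigD1_seq 1%N) ?divisors_uniq -?dvdn_divisors //=.
  rewrite {1}/no_ones eqxx mul0rn add0r.
  by apply: eq_bigr => j /negPf j1; rewrite /no_ones j1.
rewrite [RHS]big_mkcond /=; apply: eq_bigr => l _; case: ifP => l1.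
  rewrite !big_seq; apply: eq_bigr => j; rewrite mem_undup => jl.
  by rewrite /a'; case: eqP jl l1 => // -> ->.
have {}l1 : 1%N \in l by rewrite -[_ \in _]negbK l1.
rewrite (bigD1_seq 1%N) ?undup_uniq ?mem_undup //= /a' eqxx.
by rewrite -[_ == 0%N]negbK -lt0n -has_count has_pred1 l1 mul0r.
Qed.

(** With [N = (r/j) d] the double sum groups into powers [p_N^(r/N)] with coefficient [sum_(d | N)
    mob d = [N = 1]]. What remains is [p_1^r - p_r], the logarithmic derivative of
    [E(-1)/(1 - p_1)]. *)
Lemma lie_hat_rec (a : nat -> nat -> R) (L : nat -> R) :
  (forall j, (1 < j)%N -> newton (pk_ell j) (a j)) ->
  (forall n, L n = \sum_(l <- partitions n | 1%N \notin l)
       \prod_(j <- undup l) a j (count_mem j l)) ->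
  forall n, L n.+1 = p 1%N * L n + (-1) ^+ n.+1 * eseq n.+1.
Proof.
move=> na LE n.
suff E : L =1 conv (fun n => (-1) ^+ n * eseq n) (fun i => p 1%N ^+ i).
  by rewrite !E conv_geom_rec.
have nL := eq_newton (fun _ _ => erefl) (fun n => esym (LE n)) (newton_no_ones na).
have nR := newton_conv newton_eseq_sign (newton_geom (p 1%N)).
apply: newton_uniq nL nR => r r0.
(* The excluded part size 1 accounts for the term [- p_r]. *)
have p1 : pk_ell 1 r = p r.
  have m1 : mob 1%N = 1 by rewrite -[RHS](mobP (ltn0Sn 0)) big_seq1.
  by rewrite /pk_ell big_seq1 m1 invr1 !scale1r muln1.
rewrite p1 addrC; congr (_ + _).
have E j : j \in divisors r -> pk_ell j (r %/ j)%N *+ j =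
    \sum_(d <- divisors j) mob d *: p (r %/ j * d)%N ^+ (j %/ d).
  rewrite -dvdn_divisors // => /(dvdn_gt0 r0) j0.
  by rewrite -scaler_nat scalerA mulfV ?scale1r // Num.Theory.pnatr_eq0 -lt0n.
rewrite big_seq (eq_bigr _ E) -big_seq.
rewrite (sum_divisors_reindex (fun d j => mob d *: p (r %/ j * d)%N ^+ (j %/ d))) //.
rewrite big_seq (eq_bigr (fun N => (N == 1%N)%:R *: p N ^+ (r %/ N))) => [|N]; last first.
  rewrite -dvdn_divisors // => Nr; have N0 := dvdn_gt0 r0 Nr.
  rewrite -mobP // scaler_suml !big_seq; apply: eq_bigr => d.
  rewrite -dvdn_divisors // => dN; have d0 := dvdn_gt0 N0 dN.
  have [k ek] := dvdnP Nr; have [c ec] := dvdnP dN.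
  have k0 : (0 < k)%N by move: r0; rewrite ek muln_gt0 => /andP[].
  rewrite ek mulnK // mulKn //; congr (_ *: p _ ^+ _).
  by rewrite ec mulnCA [(k * d)%N]mulnC mulnK ?muln_gt0 ?d0.
rewrite -big_seq (bigD1_seq 1%N) ?divisors_uniq -?dvdn_divisors ?dvd1n //= scale1r divn1.
by rewrite big1 ?addr0 // => i /negPf ->; rewrite scale0r.
Qed.

Lemma sum_divisors1 (V : lmodType F) r N (c : F) (f : nat -> V) : (0 < r)%N ->
  \sum_(i <- divisors r) (c * (i == N)%:R) *: f i = if (N %| r)%N then c *: f N else 0.
Proof.
move=> r0; rewrite dvdn_divisors //; case: ifP => Nr.
  rewrite (bigD1_seq N) ?divisors_uniq //= eqxx mulr1 big1 ?addr0 // => i /negPf ->.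
  by rewrite mulr0 scale0r.
rewrite big1_seq // => i /andP[_ ir]; case: eqP ir => [->|_ _]; first by rewrite Nr.
by rewrite mulr0 scale0r.
Qed.

(* With these signs, e_m[pi_j] for even j becomes an expsum like h_m[pi_j]. *)
Definition pk_W j r : R := (if odd j then 1 else (-1) ^+ r.-1 : F) *: pk_piS j r.

(** Write [j = d k], [r = j c] and [N = c d]. The sign of a term depends on [d] only through
    [(-1)^(N/d)]; this is a check of parities. *)
Lemma pk_W_sign c d k : (0 < c)%N -> (0 < d)%N ->
  (if odd (d * k) then 1 else (-1) ^+ c.-1) * (-1) ^+ (d * k - k) =
  (-1) ^+ (k * (c * d) + k).+1 * (-1) ^+ c :> F.
Proof.
move=> c0 d0; case: c c0 => // c _ /=.
rewrite -exprD -[in RHS]signr_odd -[(-1) ^+ (d * k - k)]signr_odd -[(-1) ^+ c]signr_odd.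
rewrite !oddD /= oddD oddB ?leq_pmull // !oddM /=.
by case: (odd d); case: (odd k); case: (odd c); rewrite /= ?expr0 ?expr1 ?mulrNN ?mul1r ?mulr1.
Qed.

(** The alternating divisor sum leaves both [N = 1] and [N = 2]; the latter yields the logarithmic
    derivative of [1 + p_2 t^2]. *)
Lemma w_hat_rec (a : nat -> nat -> R) (L : nat -> R) :
  (forall j, (1 < j)%N -> newton (pk_W j) (a j)) ->
  (forall n, L n = \sum_(l <- partitions n | 1%N \notin l)
       \prod_(j <- undup l) a j (count_mem j l)) ->
  forall n, L n.+1 = p 1%N * L n + (-1) ^+ n.+1 *
    (eseq n.+1 + (if n is n'.+1 then p 2%N * eseq n' else 0)).
Proof.
move=> na LE n.
(* The series [1 + p_2 t^2]. *)
pose D := stretch 2 (fun n => match n with 0%N => 1 | 1%N => p 2%N | _ => 0 end).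
have D0 j : (2 < j)%N -> D j = 0.
  rewrite /D /stretch; case: ifP => // /dvdnP[q ->]; rewrite mulnK //.
  by case: q => [|[|q]].
pose G := conv D (fun n => (-1) ^+ n * eseq n).
suff E : L =1 conv G (fun i => p 1%N ^+ i).
  rewrite !E conv_geom_rec; congr (_ + _); rewrite /G /conv.
  rewrite big_ord_recl subn0 mulrDr {1}/D /stretch dvdn0 div0n mul1r; congr (_ + _).
  rewrite big_ord_recl /= {1}/D /stretch /= mul0r add0r.
  (* Index 2 of [D] enters only from degree 2 on, whence the case distinction in the statement. *)
  case: n => [|n]; first by rewrite big_ord0 mulr0.
  rewrite big_ord_recl /= {1}/D /stretch /= big1 ?addr0.
    by rewrite !exprS !mulN1r opprK mulrCA !subSS subn0.
  by move=> i _; rewrite D0 ?mul0r.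
have nL := eq_newton (fun _ _ => erefl) (fun n => esym (LE n)) (newton_no_ones na).
have nD : newton _ D := newton_stretch (ltn0Sn 1) (newton_1Dx (p 2%N)).
have nR := newton_conv (newton_conv nD newton_eseq_sign) (newton_geom (p 1%N)).
apply: newton_uniq nL nR => r r0.
have p1 : pk_W 1 r = p r.
  have m1 : mob 1%N = 1 by rewrite -[RHS](mobP (ltn0Sn 0)) big_seq1.
  by rewrite /pk_W /pk_piS big_seq1 m1 invr1 !scale1r muln1 mul1r scale1r.
rewrite p1 addrAC; congr (_ - _).
pose f d j : R := ((if odd j then 1 else (-1) ^+ (r %/ j).-1) * (-1) ^+ (j - j %/ d) * mob d) *:
     p (r %/ j * d)%N ^+ (j %/ d).
have E j : j \in divisors r -> pk_W j (r %/ j)%N *+ j = \sum_(d <- divisors j) f d j.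
  rewrite -dvdn_divisors // => /(dvdn_gt0 r0) j0.
  rewrite /pk_W /pk_piS -scaler_nat !scalerA mulrAC mulfV ?mul1r; last first.
    by rewrite Num.Theory.pnatr_eq0 -lt0n.
  by rewrite scaler_sumr; apply: eq_bigr => d _; rewrite scalerA mulrA.
rewrite big_seq (eq_bigr _ E) -big_seq sum_divisors_reindex //.
(* For [N = 1] the outer sign is [(-1)^(2r+1)], cancelling the minus sign in [mobius_alternating];
   for [N = 2] it is [(-1)^(r + r/2 + 1)], with coefficient 2. *)
rewrite big_seq (eq_bigr (fun N => (1 * (N == 1%N)%:R) *: p N ^+ (r %/ N)
   + (((-1) ^+ (r + r %/ 2).+1 *+ 2) * (N == 2%N)%:R) *: p N ^+ (r %/ N))) => [|N]; last first.
  rewrite -dvdn_divisors // => Nr; have N0 := dvdn_gt0 r0 Nr.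
  have [k ek] := dvdnP Nr.
  have k0 : (0 < k)%N by move: r0; rewrite ek muln_gt0 => /andP[].
  transitivity (((-1) ^+ (r + k).+1 * \sum_(d <- divisors N) (-1) ^+ (N %/ d) * mob d)
                 *: p N ^+ k).
    rewrite mulr_sumr scaler_suml !big_seq; apply: eq_bigr => d.
    rewrite -dvdn_divisors // => dN; have d0 := dvdn_gt0 N0 dN.
    have [c ec] := dvdnP dN.
    have c0 : (0 < c)%N by move: N0; rewrite ec muln_gt0 => /andP[].
    rewrite /f ek mulnK // mulKn //.
    have -> : (k * N %/ (d * k) = c)%N.
      by rewrite ec mulnCA [(k * d)%N]mulnC mulnK ?muln_gt0 ?d0.
    by rewrite ec mulnK // pk_W_sign // !mulrA.
  rewrite (mobius_alternating mobP) // -scalerDl.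
  have -> : (r %/ N = k)%N by rewrite ek mulnK.
  congr (_ *: _); rewrite mulrDr; congr (_ + _).
    case: eqP => [N1|_]; last by rewrite !mulr0 oppr0 mulr0.
    by rewrite ek N1 muln1 exprS addnn -muln2 exprM sqrr_sign mulr1 mulrNN.
  case: eqP => [N2|_]; last by rewrite !mulr0 mul0rn mulr0.
  by rewrite [in RHS]ek N2 mulnK // mulr1 mulr_natr ek N2.
rewrite -big_seq big_split /= !sum_divisors1 // dvd1n scale1r divn1 addrC; congr (_ + _).
rewrite /stretch; case: ifP => // r2.
have [k ->] := dvdnP r2; rewrite mulnK // exprS exprD exprM sqrr_sign mul1r.
rewrite (exprNn (p 2%N)) -(signr_odd F k) -(signr_odd R k) -scalerMnl mulN1r scaleNr.
by case: (odd k); rewrite ?expr0 ?expr1 ?scaleN1r ?scale1r ?mulN1r ?mul1r ?mulNrn.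
Qed.
End LieIdentities.

(** * Jacobi-Trudi determinants *)

Section JacobiTrudi.
Variables (F : numFieldType) (R : comAlgType F) (p : nat -> R).
Let h := expsum p.
Let e := eseq p.

(** [H(-t) E(t) = 1], because the two logarithmic derivatives cancel. *)
Lemma sum_sign_he n : \sum_(i < n.+2) (-1) ^+ i * h i * e (n.+1 - i)%N = 0.
Proof.
have nhe := newton_conv (newton_sign (newton_expsum p))
  (newton_expsum (fun r => (-1) ^+ r.-1 * p r)).
have n0 : newton (fun=> 0) (fun n => (n == 0%N)%:R : R).
  split=> // -[|m]; first by rewrite big_ord0.
  by rewrite big1 ?mul0rn // => i _; rewrite mul0r.
have := newton_uniq _ nhe n0 n.+1; apply.
by case=> // r _; rewrite exprS mulN1r mulNr addNr.
Qed.

(* Jacobi-Trudi matrix of the hook (r, 1^(k-1)). *)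
Definition hook_mx r k : 'M[R]_k :=
  \matrix_(i, j) (if i == 0%N :> nat then h (r + j)%N
                  else if (1 + j < i)%N then 0 else h (1 + j - i)%N).

(** The first column holds only [h_r] and [h_0 = 1], and both minors are again of hook shape. *)
Lemma hook_mx_rec r k :
  \det (hook_mx r k.+2) = h r * \det (hook_mx 1 k.+1) - \det (hook_mx r.+1 k.+1).
Proof.
have h0 : h 0%N = 1 by case: (newton_expsum p).
rewrite (expand_det_col _ ord0) !big_ord_recl big1 => [|i _]; last first.
  by rewrite !mxE /= /bump /= mul0r.
rewrite addr0 !mxE /= addn0 subnn h0 mul1r /cofactor /= expr1 expr0 mulN1r mul1r.
have -> : row' ord0 (col' ord0 (hook_mx r k.+2)) = hook_mx 1 k.+1.
  apply/matrixP => i j; rewrite !mxE /= /bump /=.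
  by rewrite !add1n !ltnS subSS; case: (nat_of_ord i).
suff -> : row' (lift ord0 ord0) (col' ord0 (hook_mx r k.+2)) = hook_mx r.+1 k.+1 by [].
apply/matrixP => i j; rewrite !mxE /= /bump /=.
by case: (nat_of_ord i) => [|i'] /=; rewrite !add1n ?addnS // !ltnS subSS.
Qed.

Lemma hseq0 : h 0%N = 1. Proof. by case: (newton_expsum p). Qed.

Lemma eseq0 : e 0%N = 1.
Proof. by case: (newton_expsum (fun r => (-1) ^+ r.-1 * p r)). Qed.

(** Isolates the term [i = 0] of [sum_sign_he]. The hypothesis is kept explicit because the
    induction in [det_hook_mx] calls this at the preceding size. *)
Lemma det_hook1_mx_of k :
  (forall r, \det (hook_mx r k.+1) = \sum_(i < k.+1) (-1) ^+ i * h (r + i)%N * e (k - i)%N)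
  -> \det (hook_mx 1 k.+1) = e k.+1.
Proof.
move=> ->; have := sum_sign_he k; rewrite big_ord_recl /= hseq0 !mul1r => /eqP.
rewrite addr_eq0 => /eqP ->; rewrite -sumrN; apply: eq_bigr => i _.
by rewrite subSS exprS mulN1r !mulNr opprK.
Qed.

Lemma det_hook_mx r k :
  \det (hook_mx r k.+1) = \sum_(i < k.+1) (-1) ^+ i * h (r + i)%N * e (k - i)%N.
Proof.
elim: k r => [|k IH] r; first by rewrite det_mx11 mxE big_ord1 /= eseq0 mul1r mulr1.
rewrite hook_mx_rec (det_hook1_mx_of IH) IH [RHS]big_ord_recl /= mul1r addn0 subn0.
rewrite -sumrN; apply: (congr2 +%R) => //; apply: eq_bigr => i _.
by rewrite subSS exprS mulN1r !mulNr addnS.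
Qed.

Lemma det_hook1_mx k : \det (hook_mx 1 k.+1) = e k.+1.
Proof. by apply: det_hook1_mx_of => r; apply: det_hook_mx. Qed.

(** [hook_mx_rec] read backwards: it shortens the first row until a column, with determinant [e_m],
    is reached. *)
Lemma det_hookS_mx r k :
  \det (hook_mx r.+1 k.+1) = h r * e k.+1 - \det (hook_mx r k.+2).
Proof. by rewrite hook_mx_rec det_hook1_mx opprB addrC subrK. Qed.

(* Jacobi-Trudi matrix of the partition (2, 2, 1^k). *)
Definition double_mx k : 'M[R]_k.+2 :=
  \matrix_(i, j) (if i == 0%N :> nat then h (2 + j)%N
                  else if i == 1%N :> nat then h (1 + j)%N
                  else if (1 + j < i)%N then 0 else h (1 + j - i)%N).

(** The first column is [(h_2, h_1, 0, ..., 0)], and striking out row 0 or row 1 leaves a hook. *)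
Lemma det_double_mx k :
  \det (double_mx k) =
  h 2 * \det (hook_mx 2 k.+1) - h 1 * \det (hook_mx 3 k.+1).
Proof.
rewrite (expand_det_col _ ord0) !big_ord_recl big1 => [|i _]; last first.
  by rewrite !mxE /= /bump /= mul0r.
rewrite addr0 !mxE /= !addn0 /cofactor /= expr1 expr0 mulN1r mul1r mulrN.
have -> : row' ord0 (col' ord0 (double_mx k)) = hook_mx 2 k.+1.
  apply/matrixP => i j; rewrite !mxE /= /bump /=.
  by case: (nat_of_ord i) => [|i'] /=; rewrite !add1n // !ltnS subSS.
suff -> : row' (lift ord0 ord0) (col' ord0 (double_mx k)) = hook_mx 3 k.+1 by [].
apply/matrixP => i j; rewrite !mxE /= /bump /=.
by case: (nat_of_ord i) => [|i'] /=; rewrite !add1n ?addnS // !ltnS subSS.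
Qed.

Lemma hseq1 : h 1%N = p 1%N.
Proof.
by have [_ /(_ 1%N)] := newton_expsum p; rewrite mulr1n big_ord1 subnn /= -/h hseq0 mulr1.
Qed.

Lemma eseq1 : e 1%N = p 1%N.
Proof.
have [_ /(_ 1%N)] := newton_expsum (fun r => (-1) ^+ r.-1 * p r).
by rewrite mulr1n big_ord1 subnn /= -/(eseq p) -/e eseq0 mulr1 mul1r.
Qed.

Lemma hseq2 : h 2%N *+ 2 = p 1%N ^+ 2 + p 2%N.
Proof.
have [_ ->] := newton_expsum p; rewrite !big_ord_recl big_ord0 /= /bump /= -/h.
by rewrite hseq1 hseq0 addr0 mulr1.
Qed.

Lemma eseq2 : e 2%N *+ 2 = p 1%N ^+ 2 - p 2%N.
Proof.
have [_ ->] := newton_expsum (fun r => (-1) ^+ r.-1 * p r).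
rewrite !big_ord_recl big_ord0 /= /bump /= -/(eseq p) -/e.
by rewrite eseq1 eseq0 addr0 mulr1 mul1r expr1 mulN1r.
Qed.

(** Once every hook is reduced to [h_1], [h_2] and the [e_m], a polynomial identity remains, with
    [p_2 = 2 h_2 - h_1^2]. *)
Lemma det_hook_sub_double k :
  \det (hook_mx 3 k.+2) - \det (double_mx k) = e k.+4 + p 2%N * e k.+2.
Proof.
have hook2 m : \det (hook_mx 2 m.+1) = h 1 * e m.+1 - e m.+2.
  by rewrite det_hookS_mx det_hook1_mx.
have p2 : p 2%N = h 2 *+ 2 - h 1 ^+ 2 by rewrite hseq2 hseq1 addrC addKr.
rewrite det_double_mx !(det_hookS_mx 2) !hook2 p2; ring.
Qed.

(** In degrees at most 3, where [tau] is trivial with characteristic [h_n], the same formula in [e]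
    and [p_2] holds. *)
Lemma hseq_small n : (n < 3)%N ->
  h n.+1 = e n.+1 + (if n is n'.+1 then p 2%N * e n' else 0).
Proof.
have e2 : h 2 = e 2 + p 2%N.
  by apply: (@mulrSnI _ _ 1); rewrite /= mulrnDl hseq2 eseq2; ring.
case: n => [|[|[|n]]] // _; first by rewrite hseq1 eseq1 addr0.
  by rewrite eseq0 mulr1.
apply: (@mulrSnI _ _ 2); rewrite /= mulrnDl.
have [_ ->] := newton_expsum p; rewrite !big_ord_recl big_ord0 /= /bump /= -/h.
have [_ ->] := newton_expsum (fun r => (-1) ^+ r.-1 * p r).
rewrite !big_ord_recl big_ord0 /= /bump /= -/(eseq p) -/e.
by rewrite e2 hseq1 eseq1 hseq0 eseq0; ring.
Qed.
End JacobiTrudi.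

(** * Symmetric functions as polynomials in the power sums *)

Lemma bparts_uniq m k : uniq (bparts m k).
Proof.
elim: k m => [|k IHk]; first by case.
elim/ltn_ind=> -[|m] IHm //; rewrite bparts_rec // cat_uniq IHk andbT.
case: ltnP => [km|_]; last by apply/hasPn.
rewrite map_inj_uniq => [|l1 l2 [] //]; rewrite IHm; last by rewrite subSS ltnS leq_subr.
apply/hasPn => l /bpartsP[al _ _]; apply/mapP => -[l' _ el].
by move: al; rewrite el /= ltnn.
Qed.

Lemma mem_bparts k l : all (fun i => 0 < i <= k)%N l -> sorted geq l ->
  l \in bparts (sumn l) k.
Proof.
elim: k l => [|k IHk] l; first by case: l => [|[|x] l].
elim: l => [|x l IHl] //= /andP[/andP[x0 xk] al] pl.
rewrite bparts_rec ?addn_gt0 ?x0 // mem_cat; have [xE|xE] := eqVneq x k.+1.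
  rewrite xE leq_addr addKn mem_map ?IHl //; first exact: path_sorted pl.
  by move=> l1 l2 [].
have xk' : (x <= k)%N by rewrite -ltnS ltn_neqAle xE.
rewrite [X in _ || X](IHk (x :: l)) ?orbT //= x0 xk' /=.
have /allP lx := order_path_min (fun _ _ _ a b => leq_trans b a) pl.
by apply/allP => i il; have /andP[-> _] := allP al i il; apply: leq_trans xk'; apply: lx.
Qed.

Lemma prod_sign_pred (F : pzRingType) (mu : seq nat) : all (leq 1) mu ->
  \prod_(i <- mu) (-1) ^+ i.-1 = (-1) ^+ (sumn mu - size mu) :> F.
Proof.
elim: mu => [|i mu IH] /= => [_|/andP[i0 al]]; first by rewrite big_nil.
rewrite big_cons IH // -exprD; congr (_ ^+ _).
have le : (size mu <= sumn mu)%N.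
  elim: mu al {IH} => //= j mu IH /andP[j0 al].
  by rewrite -add1n leq_add ?IH.
by case: i i0 => // i _; rewrite addSn subSS addnBA.
Qed.

Section MPoly.
Variable N : nat.
Local Notation R := {mpoly algC[N]}.

Definition mexp (l : seq nat) : 'X_{1..N} := [multinom count_mem i.+1 l | i < N].

(* p_i, set to 0 when i = 0 or i > N. *)
Definition psum (i : nat) : R := if (0 < i <= N)%N then 'X_[mexp [:: i]] else 0.

Definition part_le (l : seq nat) := all (fun i => 0 < i <= N)%N l && sorted geq l.

(** Agreement is asked only at partitions with parts at most [N], where [mexp] is injective;
    elsewhere, as on unsorted lists, an [sf] may take any value. *)
Definition rep (f : sf) (P : R) : Prop := forall l, part_le l -> f l = P@_(mexp l).

Lemma mexp_cat l1 l2 : mexp (l1 ++ l2) = (mexp l1 + mexp l2)%MM.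
Proof. by apply/mnmP => i; rewrite !mnmE count_cat. Qed.

Lemma mexp_perm l1 l2 : perm_eq l1 l2 -> mexp l1 = mexp l2.
Proof. by move=> /seq.permP e; apply/mnmP => i; rewrite !mnmE e. Qed.

Lemma geq_trans : transitive geq.
Proof. by move=> x y z /= yx zy; apply: leq_trans zy yx. Qed.

Lemma geq_anti : antisymmetric geq.
Proof. by move=> x y; rewrite /= andbC; apply: anti_leq. Qed.

Lemma geq_total : total geq.
Proof. by move=> x y; apply: leq_total. Qed.

Lemma sf_sort_sorted l : sorted geq l -> sf_sort l = l.
Proof. by move=> s; apply: sorted_sort => //; apply: geq_trans. Qed.

Lemma perm_sf_sort l1 l2 : perm_eq l1 l2 -> sf_sort l1 = sf_sort l2.
Proof. move=> e; exact/(perm_sortP geq_total geq_trans geq_anti). Qed.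

Lemma mexp_inj l1 l2 : part_le l1 -> part_le l2 -> mexp l1 = mexp l2 -> l1 = l2.
Proof.
move=> /andP[al1 s1] /andP[al2 s2] e.
apply: (sorted_eq geq_trans geq_anti) => //; apply/allP => x _ /=; apply/eqP.
have out l : all (fun i => 0 < i <= N)%N l -> ~~ (0 < x <= N)%N -> count_mem x l = 0%N.
  by move=> al nx; apply/count_memPn; apply: contra nx => /(allP al).
case: (boolP (0 < x <= N)%N) => [/andP[x0 xN]|nx]; last by rewrite !out.
have xN' : (x.-1 < N)%N by rewrite prednK.
by have /mnmP/(_ (Ordinal xN')) := e; rewrite !mnmE /= prednK.
Qed.

Lemma coef_psum_prod mu l : part_le l -> all (leq 1) mu ->
  (\prod_(i <- mu) psum i)@_(mexp l) = (l == sf_sort mu)%:R.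
Proof.
move=> gl mu0; have pmu : perm_eq (sf_sort mu) mu by rewrite perm_sort.
case: (boolP (all (geq N) mu)) => [muN|].
  have E : \prod_(i <- mu) psum i = 'X_[mexp mu].
    elim: mu mu0 muN {pmu} => [|x mu IH] /=.
      by rewrite big_nil -mpolyX0 => _ _; congr 'X_[_]; apply/mnmP => i; rewrite !mnmE.
    move=> /andP[x0 mu0] /andP[xN muN]; rewrite big_cons IH // /psum x0 [(x <= N)%N]xN.
    by rewrite -mpolyXD -mexp_cat.
  rewrite E mcoeffX -(mexp_perm pmu); congr (_%:R); congr nat_of_bool.
  apply/eqP/eqP => [/esym/mexp_inj->//|-> //].
  rewrite /part_le sort_sorted ?andbT; last exact: geq_total.
  rewrite (perm_all _ pmu); apply/allP => x xmu.
  by have := allP mu0 _ xmu; have /= := allP muN _ xmu => -> ->.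
(* If a part exceeds [N], its [psum] is 0, and [l], having no such part, differs from the sorted
   [mu]. *)
move=> /allPn[x xmu xN]; rewrite (big_rem x) //= {1}/psum.
rewrite [(x <= N)%N](negPf xN) andbF mul0r mcoeff0; case: eqP => // el.
have : x \in l by rewrite el (perm_mem pmu).
move=> xl; have /andP[/allP/(_ _ xl)/andP[_ xN']] := gl.
by rewrite /= xN' in xN.
Qed.

Lemma coef_psumX d e l : part_le l -> (0 < d)%N ->
  (psum d ^+ e)@_(mexp l) = (l == nseq e d)%:R.
Proof.
move=> gl d0; have E : psum d ^+ e = \prod_(i <- nseq e d) psum i.
  by rewrite big_nseq -Monoid.iteropE.
rewrite E coef_psum_prod //; last by rewrite all_nseq d0 orbT.
rewrite sf_sort_sorted //; elim: e {E} => [|[|e]] //= ->.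
by rewrite leqnn.
Qed.

Lemma rep_one : rep sf_one 1.
Proof.
move=> l gl; rewrite /sf_one mcoeff1.
have -> : 0%MM = mexp [::] by apply/mnmP => i; rewrite !mnmE.
by congr (nat_of_bool _)%:R; apply/eqP/eqP => [->|/mexp_inj->].
Qed.

Lemma rep_scale c f P : rep f P -> rep (fun l => c * f l) (c *: P).
Proof. by move=> fP l gl; rewrite mcoeffZ fP. Qed.

Lemma rep_sum (I : eqType) (s : seq I) (f : I -> sf) (P : I -> R) :
  {in s, forall i, rep (f i) (P i)} ->
  rep (fun l => \sum_(i <- s) f i l) (\sum_(i <- s) P i).
Proof.
by move=> fP l gl; rewrite raddf_sum /= !big_seq; apply: eq_bigr => i /fP; apply.
Qed.

Lemma count_mask (T : eqType) (a : pred T) (t : bitseq) l : size t = size l ->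
  (count a (mask t l) + count a (mask (map negb t) l))%N = count a l.
Proof.
elim: t l => [|b t IH] [|x l] //= [/IH <-].
by case: b => /=; [rewrite addnA | rewrite addnCA].
Qed.

Lemma mexp_sf_sort l : mexp (sf_sort l) = mexp l.
Proof. by apply: mexp_perm; rewrite perm_sort. Qed.

Lemma part_le_mask t l : part_le l -> part_le (mask t l).
Proof.
move=> /andP[al sl]; rewrite /part_le (sorted_mask geq_trans) // andbT.
by apply/allP => x /mem_mask /(allP al).
Qed.

(** The multiset with multiplicities [m1] is contained in [l], hence is a permutation of a
    subsequence, whose mask is the witness. *)
Lemma mask_of_mexp l m1 m2 : part_le l -> mexp l = (m1 + m2)%MM ->
  exists2 t : (size l).-tuple bool, mexp (mask t l) = m1
                                  & mexp (mask (map negb t) l) = m2.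
Proof.
move=> gl el.
pose s1 := flatten [seq nseq (m1 i) i.+1 | i <- enum 'I_N].
have cs1 x : count_mem x s1 = (\sum_(i < N) (i.+1 == x) * m1 i)%N.
  rewrite /s1 count_flatten sumnE 2!big_map big_enum /=.
  by apply: eq_bigr => i _; rewrite count_nseq.
have c1 (i : 'I_N) : count_mem i.+1 s1 = m1 i.
  rewrite cs1 (bigD1 i) //= eqxx mul1n big1 ?addn0 // => j ji.
  by rewrite eqSS val_eqE (negPf ji).
have [|s /subseqP[t st ->] ps] := (count_subseqP s1 l).1.
  move=> x; case: (boolP (0 < x <= N)%N) => [/andP[x0 xN]|nx].
    have xN' : (x.-1 < N)%N by rewrite prednK.
    have := c1 (Ordinal xN'); rewrite /= prednK // => ->.
    by have /mnmP/(_ (Ordinal xN')) := el; rewrite mnmDE mnmE /= prednK // => ->; apply: leq_addr.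
  rewrite cs1 big1 // => i _; case: eqP => // ix.
  by rewrite -ix ltn_ord in nx.
have E1 : mexp (mask t l) = m1.
  by rewrite -(mexp_perm ps); apply/mnmP => i; rewrite mnmE c1.
have st' : size t == size l by apply/eqP.
exists (Tuple st') => //=; apply: (@addmI _ m1); rewrite -el -{1}E1.
by apply/mnmP => i; rewrite mnmDE !mnmE count_mask.
Qed.

Lemma mexp_mask (t : bitseq) l : size t = size l ->
  mexp l = (mexp (mask t l) + mexp (mask (map negb t) l))%MM.
Proof. by move=> st; apply/mnmP => i; rewrite mnmDE !mnmE count_mask. Qed.

(** [undup] keeps one pair per splitting of the multiset [l] in two, and these pairs correspond
    bijectively to the factorisations of the monomial [mexp l]. *)
Lemma rep_mul f g P Q : rep f P -> rep g Q -> rep (sf_mul f g) (P * Q).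
Proof.
move=> fP gQ l gl; rewrite /sf_mul mcoeffM.
set S := undup _; set d := (mdeg (mexp l)).+1.
have SP x : x \in S -> exists2 t : (size l).-tuple bool, part_le x.1 /\ part_le x.2 &
   x = (mask t l, mask (map negb t) l).
  rewrite mem_undup => /mapP[t _ ->]; exists t.
    by rewrite !sf_sort_sorted; [split| |]; rewrite ?part_le_mask //;
      have /andP[] := part_le_mask (map negb t) gl; have /andP[] := part_le_mask t gl.
  by congr pair; apply: sf_sort_sorted; [have /andP[] := part_le_mask t gl|
     have /andP[] := part_le_mask (map negb t) gl].
pose phi (x : seq nat * seq nat) := (mexp x.1, mexp x.2).
pose psi (k : 'X_{1..N < d, d}) : 'X_{1..N} * 'X_{1..N} := (bmnm k.1, bmnm k.2).
transitivity (\sum_(y <- map phi S) P@_(y.1) * Q@_(y.2)).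
  rewrite big_map !big_seq; apply: eq_bigr => x /SP[t [g1 g2] _].
  by rewrite (fP _ g1) (gQ _ g2).
rewrite -[RHS]big_filter -[RHS](big_map psi xpredT (fun y => P@_(y.1) * Q@_(y.2))).
apply: perm_big; apply: uniq_perm.
- rewrite map_inj_in_uniq ?undup_uniq // => x y /SP[_ [x1 x2] _] /SP[_ [y1 y2] _].
  move=> exy; have e1 := mexp_inj x1 y1 (congr1 fst exy).
  have e2 := mexp_inj x2 y2 (congr1 snd exy).
  by rewrite [x]surjective_pairing [y]surjective_pairing e1 e2.
- rewrite map_inj_uniq ?filter_uniq ?index_enum_uniq // => -[k1 k2] [k3 k4].
  move=> e; congr pair; apply: val_inj; [exact: (congr1 fst e)|exact: (congr1 snd e)].
move=> [m1 m2]; apply/mapP/mapP => [[x /SP[t _ ->] [-> ->]]|[k]].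
  have E := mexp_mask (size_tuple t).
  have le1 : (mdeg (mexp (mask t l)) < d)%N by rewrite ltnS E mdegD leq_addr.
  have le2 : (mdeg (mexp (mask (map negb t) l)) < d)%N by rewrite ltnS E mdegD leq_addl.
  exists (BMultinom le1, BMultinom le2) => //.
  by rewrite mem_filter mem_index_enum andbT; apply/eqP.
rewrite mem_filter => /andP[/eqP ek _] [-> ->].
have [t t1 t2] := mask_of_mexp gl ek.
exists (sf_sort (mask t l), sf_sort (mask (map negb t) l)).
  by rewrite mem_undup; apply/mapP; exists t; rewrite ?mem_enum.
by rewrite /phi /= !mexp_sf_sort t1 t2.
Qed.

Lemma rep_prod (I : eqType) (s : seq I) (f : I -> sf) (P : I -> R) :
  {in s, forall i, rep (f i) (P i)} ->
  rep (sf_prod [seq f i | i <- s]) (\prod_(i <- s) P i).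
Proof.
elim: s => [|i s IH] fP /=; first by rewrite big_nil; apply: rep_one.
rewrite big_cons; apply: rep_mul; first by apply: fP; rewrite mem_head.
by apply: IH => j js; apply: fP; rewrite in_cons js orbT.
Qed.

(** [z_mu] is a product over distinct parts, so the weights recombine into the usual [z_mu^-1]
    expansion of [h_n]. *)
Lemma expsum_zee (x : nat -> R) n :
  expsum x n = \sum_(mu <- partitions n) (zee mu)%:R^-1 *: \prod_(i <- mu) x i.
Proof.
apply: eq_bigr => mu _; rewrite scaler_prod; congr (_ *: _).
  rewrite /zee prodfV; congr (_^-1); by rewrite natr_prod.
by rewrite -[RHS]big_undup_iterop_count.
Qed.

Lemma rep_pleth_h g (G : nat -> R) m :
  (forall i, (0 < i)%N -> rep (sf_pk i g) (G i)) -> rep (pleth_h m g) (expsum G m).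
Proof.
move=> gG; rewrite expsum_zee; apply: rep_sum => mu /bpartsP[al _ _]; apply: rep_scale.
by apply: rep_prod => i /(allP al)/andP[i0 _]; apply: gG.
Qed.

(** Since [m - size mu] is the sum of [i - 1] over the parts [i], the sign is absorbed part by part
    into [G]. *)
Lemma rep_pleth_e g (G : nat -> R) m :
  (forall i, (0 < i)%N -> rep (sf_pk i g) (G i)) ->
  rep (pleth_e m g) (expsum (fun i => ((-1) ^+ i.-1 : algC) *: G i) m).
Proof.
move=> gG; rewrite expsum_zee; apply: rep_sum => mu /bpartsP[al sl _].
rewrite scaler_prod scalerA [X in _ (X *: _)]mulrC.
rewrite prod_sign_pred // -?sl; last by apply: sub_all al => i /andP[].
apply: rep_scale; apply: rep_prod => i /(allP al)/andP[i0 _]; exact: gG.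
Qed.

Lemma rep_sf_h m : rep (sf_h m) (expsum psum m).
Proof.
rewrite expsum_zee; apply: rep_sum => mu /bpartsP[al _ _]; apply: rep_scale => l gl.
by rewrite coef_psum_prod //; apply: sub_all al => i /andP[].
Qed.

Lemma coef_expsum (c : nat -> algC) n l : part_le l -> sumn l = n ->
  (expsum (fun i => c i *: psum i) n)@_(mexp l) = (zee l)%:R^-1 * \prod_(i <- l) c i.
Proof.
move=> gl sl; rewrite expsum_zee raddf_sum /=.
have ln : l \in partitions n.
  have /andP[al so] := gl; rewrite -sl; apply: mem_bparts => //.
  apply/allP => i il; have /andP[-> _] := allP al i il.
  by rewrite (perm_sumn (perm_to_rem il)) leq_addr.
rewrite (bigD1_seq l) ?bparts_uniq //= [X in _ + X]big1_seq ?addr0 => [|mu /andP[mul mun]].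
  rewrite mcoeffZ scaler_prod mcoeffZ coef_psum_prod //.
    by rewrite sf_sort_sorted ?eqxx ?mulr1 //; case/andP: gl.
  by have /andP[+ _] := gl; apply: sub_all => i /andP[].
have [al _ so] := bpartsP mun.
rewrite mcoeffZ scaler_prod mcoeffZ coef_psum_prod //; last by apply: sub_all al => i /andP[].
by rewrite sf_sort_sorted // eq_sym (negPf mul) !mulr0.
Qed.

Lemma rep_schur lam : rep (schur lam)
  (\det (\matrix_(i < size lam, j < size lam)
     (if (nth 0 lam i + j < i)%N then 0 else expsum psum (nth 0 lam i + j - i)%N))).
Proof.
apply: rep_sum => s _; rewrite mulr_sign -scaler_sign; apply: rep_scale.
rewrite -big_enum; apply: rep_prod => i _; rewrite mxE.
by case: ifP => _; [move=> l gl; rewrite mcoeff0 | apply: rep_sf_h].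
Qed.

(** * Plethysms of [ell_j] and [pi_j] *)

Section PlethysmLie.
Variable mob : nat -> algC.
Hypothesis ellE : forall j l, (0 < j)%N ->
  ell j l = j%:R^-1 * \sum_(d <- divisors j) mob d * (l == nseq (j %/ d) d)%:R.

(** This is [p_i[p_d^e] = p_(i d)^e]. *)
Lemma rep_pk_nseq i d e (f : sf) : (0 < i)%N -> (0 < d)%N ->
  (forall l, f l = (l == nseq e d)%:R) -> rep (sf_pk i f) (psum (i * d) ^+ e).
Proof.
move=> i0 d0 fE l gl; rewrite coef_psumX ?muln_gt0 ?i0 // /sf_pk i0 fE /=.
case: (boolP (all _ _)) => al.
  have -> : nseq e (i * d)%N = map (muln i) (nseq e d) by rewrite map_nseq.
  congr (nat_of_bool _)%:R.
  have el : map (muln i) (map (fun x => x %/ i)%N l) = l.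
    rewrite -map_comp -[RHS]map_id; apply/eq_in_map => x xl /=.
    by rewrite mulnC divnK ?(allP al).
  have inj_i : injective (muln i) by move=> x y /eqP; rewrite eqn_pmul2l // => /eqP.
  by rewrite -[in RHS]el (inj_eq (inj_map inj_i)).
case: eqP => // el; case/negP: al; rewrite el all_nseq dvdn_mulr ?orbT //.
Qed.

Lemma rep_pk_divisors i j (c : nat -> algC) (f : sf) : (0 < j)%N -> (0 < i)%N ->
  (forall l, f l = j%:R^-1 * \sum_(d <- divisors j) c d * (l == nseq (j %/ d) d)%:R) ->
  rep (sf_pk i f) (j%:R^-1 *: \sum_(d <- divisors j) c d *: psum (i * d) ^+ (j %/ d)).
Proof.
move=> j0 i0 fE l gl.
have E : j%:R^-1 *: (\sum_(d <- divisors j) c d *: psum (i * d) ^+ (j %/ d)) =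
   \sum_(d <- divisors j) (j%:R^-1 * c d) *: psum (i * d) ^+ (j %/ d).
  by rewrite scaler_sumr; apply: eq_bigr => d _; rewrite scalerA.
pose fd d : sf := fun l => (l == nseq (j %/ d) d)%:R.
have R0 : rep (fun l => \sum_(d <- divisors j) (j%:R^-1 * c d) * sf_pk i (fd d) l)
    (\sum_(d <- divisors j) (j%:R^-1 * c d) *: psum (i * d) ^+ (j %/ d)).
  apply: rep_sum => d; rewrite -dvdn_divisors // => dj; apply: rep_scale.
  by apply: rep_pk_nseq => //; apply: dvdn_gt0 dj.
rewrite E -R0 // /sf_pk fE; case: ifP => _; last by rewrite big1 // => d _; rewrite mulr0.
by rewrite mulr_sumr; apply: eq_bigr => d _; rewrite mulrA.
Qed.

Lemma rep_pk_ell j i : (0 < j)%N -> (0 < i)%N ->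
  rep (sf_pk i (ell j)) (pk_ell psum mob j i).
Proof. by move=> j0 i0; apply: rep_pk_divisors => // l; apply: ellE. Qed.

Lemma rep_pk_piS j i : (0 < j)%N -> (0 < i)%N ->
  rep (sf_pk i (piS j)) (pk_piS psum mob j i).
Proof.
move=> j0 i0; apply: rep_pk_divisors => // l.
rewrite /piS /sf_omega ellE // mulrCA; congr (_ * _); rewrite mulr_sumr !big_seq.
apply: eq_bigr => d; rewrite -dvdn_divisors // => dj; rewrite mulrA.
(* Only [l = d^(j/d)] counts, and there [omega] contributes [(-1)^(j - j/d)]. *)
case: eqP => [->|_]; last by rewrite !mulr0.
by rewrite sumn_nseq size_nseq mulnC divnK.
Qed.

Lemma rep_LieSF n lam : lam \in partitions n ->
  rep (LieSF lam) (\prod_(j <- undup lam) expsum (pk_ell psum mob j) (count_mem j lam)).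
Proof.
move=> /bpartsP[al _ _]; apply: rep_prod => j; rewrite mem_undup => /(allP al)/andP[j0 _].
by apply: rep_pleth_h => i i0; apply: rep_pk_ell.
Qed.

Lemma rep_WSF n lam : lam \in partitions n ->
  rep (WSF lam) (\prod_(j <- undup lam) expsum (pk_W psum mob j) (count_mem j lam)).
Proof.
move=> /bpartsP[al _ _]; apply: rep_prod => j; rewrite mem_undup => /(allP al)/andP[j0 _].
rewrite /pk_W; case: (odd j).
  by apply: rep_pleth_h => i i0; rewrite scale1r; apply: rep_pk_piS.
by apply: rep_pleth_e => i i0; apply: rep_pk_piS.
Qed.
End PlethysmLie.
End MPoly.

(** * Cycle types *)

Lemma cf_of_funE (gT : finGroupType) (G : {group gT}) (f : gT -> algC) x :
  {in G &, forall y z, f (y ^ z)%g = f y} -> x \in G -> cf_of_fun G f x = f x.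
Proof.
move=> fJ xG; rewrite /cf_of_fun sum_cfunE (bigD1 (x ^: G)%g) ?mem_classes //=.
rewrite cfunE cfun_classE xG class_refl mulr1 big1 ?addr0 => [|C /andP[/imsetP[y yG ->] ne]].
  by case: (repr_class G x) => z zG ->; apply: fJ.
rewrite cfunE cfun_classE yG /=; case: (boolP (x \in _)) => [xy|_]; last by rewrite mulr0.
by case/eqP: ne; apply/esym/class_eqP.
Qed.

Lemma perm_enum_imset (T T' : finType) (g : T -> T') (A : {set T}) :
  injective g -> perm_eq (enum (g @: A)) (map g (enum A)).
Proof.
move=> gi; apply: uniq_perm; rewrite ?enum_uniq ?map_inj_uniq ?enum_uniq // => x.
rewrite mem_enum; apply/imsetP/mapP => [[y yA ->]|[y]].
  by exists y; rewrite ?mem_enum.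
by rewrite mem_enum => yA ->; exists y.
Qed.

Lemma card_enum_imset (T T' : finType) (g : T -> T') (A : {set {set T}}) :
  injective g ->
  perm_eq (map (fun X : {set T'} => #|X|) (enum ((fun X : {set T} => g @: X) @: A)))
          (map (fun X : {set T} => #|X|) (enum A)).
Proof.
move=> gi; apply: perm_trans (perm_map _ (perm_enum_imset _ (imset_inj gi))) _.
by rewrite -map_comp (eq_map (g := fun X : {set T} => #|X|)) // => X /=; apply: card_imset.
Qed.

Section CycleType.
Variable n : nat.
Implicit Types s y : 'S_n.

Lemma cycle_typeJ s y : cycle_type (s ^ y)%g = cycle_type s.
Proof.
suff E : porbits (s ^ y)%g = (fun X : {set 'I_n} => y @: X) @: porbits s.
  by rewrite /cycle_type; apply: perm_sf_sort; rewrite E card_enum_imset //; apply: perm_inj.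
have P x : porbit (s ^ y)%g (y x) = y @: porbit s x.
  apply/setP => z; apply/porbitP/imsetP => [[i ->]|[_ /porbitP[i ->] ->]].
    by exists ((s ^+ i)%g x); rewrite ?mem_porbit // -conjXg permJ.
  by exists i; rewrite -conjXg permJ.
apply/setP => X; apply/imsetP/imsetP => [[x _ ->]|[_ /imsetP[x _ ->] ->]].
  by exists (porbit s (y^-1%g x)); rewrite ?imset_f // -P permKV.
by exists (y x).
Qed.

Lemma porbits_partition s : partition (porbits s) [set: 'I_n].
Proof.
suff -> : porbits s = equivalence_partition (fun x y : 'I_n => y \in porbit s x) [set: 'I_n].
  apply: equivalence_partitionP => x y z _ _ _; split; first exact: porbit_id.
  by rewrite -!eq_porbit_mem => /eqP <-.
apply/setP => X; apply/imsetP/imsetP => -[x _ ->]; exists x => //; apply/setP => y;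
  by rewrite !inE.
Qed.

Lemma sumn_cycle_type s : sumn (cycle_type s) = n.
Proof.
rewrite (perm_sumn (_ : perm_eq _ (map (fun X : {set 'I_n} => #|X|) (enum (porbits s))))).
  rewrite sumnE big_map big_enum /= -(card_partition (porbits_partition s)).
  by rewrite cardsT card_ord.
by rewrite perm_sort.
Qed.

Lemma size_cycle_type s : size (cycle_type s) = #|porbits s|.
Proof. by rewrite size_sort size_map -cardE. Qed.

Lemma part_le_cycle_type N s : (n <= N)%N -> part_le N (cycle_type s).
Proof.
move=> nN; rewrite /part_le sort_sorted ?andbT; last exact: geq_total.
rewrite all_sort all_map; apply/allP => X; rewrite mem_enum => /imsetP[x _ ->] /=.
rewrite lt0n card_porbit_neq0 (leq_trans _ nN) //.
by rewrite -[X in (_ <= X)%N]card_ord max_card.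
Qed.

Lemma odd_perm_cycle_type s : (-1) ^+ odd_perm s = (-1) ^+ (n - size (cycle_type s)) :> algC.
Proof.
have le : (size (cycle_type s) <= n)%N.
  rewrite size_cycle_type -[X in (_ <= X)%N]card_ord; exact: leq_imset_card.
by rewrite -[RHS]signr_odd oddB // size_cycle_type /odd_perm card_ord.
Qed.

Lemma count1_cycle_type s : count_mem 1%N (cycle_type s) = #|[set x | s x == x]|.
Proof.
have -> : count_mem 1%N (cycle_type s) =
    count_mem 1%N (map (fun X : {set 'I_n} => #|X|) (enum (porbits s))).
  by apply/seq.permP; rewrite perm_sort.
rewrite count_map -size_filter.
have fixP x : porbit s x = [set x] <-> s x = x.
  split=> [e|e]; first by apply/set1P; rewrite -e -{1}[s]expg1 mem_porbit.
  apply/setP => y; rewrite inE; apply/porbitP/eqP => [[i ->]|->].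
    by rewrite permX; elim: i => //= i ->.
  by exists 0%N; rewrite expg0 perm1.
rewrite -(card_imset _ (@set1_inj 'I_n)) cardE; apply/perm_size/uniq_perm.
- by rewrite filter_uniq ?enum_uniq.
- exact: enum_uniq.
move=> X; rewrite mem_filter !mem_enum; apply/andP/imsetP => [[/= c1 /imsetP[x _ eX]]|[x]].
  move: c1; rewrite eX => /cards1P[z ez]; exists x.
    rewrite inE; apply/eqP/fixP; rewrite ez; congr [set _]; apply/esym/set1P.
    by rewrite -ez porbit_id.
  by rewrite ez; congr [set _]; apply/esym/set1P; rewrite -ez porbit_id.
by rewrite inE => /eqP/fixP e ->; rewrite /= cards1 -e imset_f.
Qed.

Lemma chinvE (F : sf) s : chinv n F s = (zee (cycle_type s))%:R * F (cycle_type s).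
Proof. by rewrite /chinv cf_of_funE ?inE // => y z _ _; rewrite cycle_typeJ. Qed.

Lemma sign_cfE s : sign_cf n s = (-1) ^+ odd_perm s.
Proof. by rewrite /sign_cf cf_of_funE ?inE // => y z _ _; rewrite odd_permJ. Qed.
End CycleType.

(** * Adjoining a fixed point *)

Section Lift.
Variable m : nat.

Lemma lift_permX (t : 'S_m) k :
  (lift_perm ord_max ord_max t ^+ k = lift_perm ord_max ord_max (t ^+ k))%g.
Proof. by elim: k => [|k IH]; rewrite ?lift_perm1 // !expgS IH lift_permM. Qed.

(** The lift adds the orbit of [ord_max] and carries over the others; both lists are sorted, so
    agreement as multisets suffices. *)
Lemma cycle_type_lift (t : 'S_m) :
  cycle_type t = rem 1%N (cycle_type (lift_perm ord_max ord_max t)).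
Proof.
set s := lift_perm _ _ t.
have smax : porbit s ord_max = [set ord_max].
  apply/setP => y; rewrite inE; apply/porbitP/eqP => [[i ->]|->].
    by rewrite lift_permX lift_perm_id.
  by exists 0%N; rewrite expg0 perm1.
have slift x : porbit s (lift ord_max x) = lift ord_max @: porbit t x.
  apply/setP => z; apply/porbitP/imsetP => [[i ->]|[_ /porbitP[i ->] ->]].
    by exists ((t ^+ i)%g x); rewrite ?mem_porbit // lift_permX lift_perm_lift.
  by exists i; rewrite lift_permX lift_perm_lift.
set L := (fun X : {set 'I_m} => lift ord_max @: X) @: porbits t.
have E : porbits s = [set ord_max] |: L.
  apply/setP => X; rewrite in_setU1; apply/imsetP/orP => [[x _ ->]|].
    case: (unliftP ord_max x) => [x'|] ->; last by rewrite smax eqxx; left.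
    by rewrite slift; right; apply/imset_f/imset_f.
  case=> [/eqP->|/imsetP[_ /imsetP[x _ ->] ->]]; first by exists ord_max.
  by exists (lift ord_max x).
have nL : [set ord_max] \notin L.
  apply/imsetP => -[_ /imsetP[x _ ->]] /setP /(_ (lift ord_max x)).
  rewrite imset_f ?porbit_id // inE => /eqP e.
  by have := neq_lift ord_max x; rewrite e eqxx.
have P : perm_eq (cycle_type s) (1%N :: cycle_type t).
  rewrite perm_sort.
  apply: (@perm_trans _ (map (fun X : {set 'I_m.+1} => #|X|) ([set ord_max] :: enum L))).
    apply: perm_map; apply: uniq_perm; rewrite ?enum_uniq //= ?mem_enum ?nL ?enum_uniq //.
    by move=> X; rewrite mem_enum E in_setU1 in_cons mem_enum.
  rewrite /= cards1 perm_cons perm_sym perm_sort perm_sym; apply: card_enum_imset.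
  exact: lift_inj.
have mem1 : 1%N \in cycle_type s by rewrite (perm_mem P) mem_head.
apply: (sorted_eq geq_trans geq_anti).
- by apply: sort_sorted; apply: geq_total.
- apply: (subseq_sorted geq_trans (rem_subseq _ _)).
  by apply: sort_sorted; apply: geq_total.
by rewrite perm_sym -(perm_cons 1%N) (perm_trans _ P) // perm_sym perm_to_rem.
Qed.

Lemma lift_perm_onto (u : 'S_m.+1) : u ord_max = ord_max ->
  exists t : 'S_m, lift_perm ord_max ord_max t = u.
Proof.
move=> umax.
pose f (x : 'I_m) := odflt x (unlift ord_max (u (lift ord_max x))).
(* As [u] is injective and fixes [ord_max], it maps lifted points to lifted points. *)
have fE x : lift ord_max (f x) = u (lift ord_max x).
  rewrite /f; case: unliftP => [y -> //|]; rewrite -{2}umax => /perm_inj e.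
  by have := neq_lift ord_max x; rewrite e eqxx.
have fi : injective f.
  by move=> x y e; apply/(@lift_inj _ ord_max)/(@perm_inj _ u); rewrite -!fE e.
exists (perm fi); apply/permP => x.
case: (unliftP ord_max x) => [x'|] ->; last by rewrite lift_perm_id umax.
by rewrite lift_perm_lift permE fE.
Qed.
End Lift.

(** * Induction from a point stabiliser *)

(** Only the factor [c!] of the [c] ones changes, to [(c - 1)!]. The extra [c] later matches the
    fixed-point count of the induced character. *)
Lemma zee_rem1 (mu : seq nat) : all (leq 1) mu -> 1%N \in mu ->
  zee mu = (count_mem 1%N mu * zee (rem 1%N mu))%N.
Proof.
move=> mu0 mu1; pose a j c : algC := ((j ^ c * c`!)%N)%:R.
pose k := (sumn mu).
have zeeE l : all (fun i => 0 < i <= k.+1)%N l -> (zee l)%:R = wt a k.+1 l.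
  by move=> al; rewrite -wt_undup // /zee natr_prod.
have al : all (fun i => 0 < i <= k.+1)%N mu.
  apply/allP => i imu; have := allP mu0 _ imu; rewrite /= => ->.
  by rewrite leqW // /k (perm_sumn (perm_to_rem imu)) leq_addr.
apply/eqP; rewrite -(eqr_nat algC) natrM !zeeE //; last first.
  by apply/allP => i /mem_rem /(allP al).
rewrite /wt !big_ord_recl /= mulrA; apply/eqP; congr (_ * _).
  rewrite count_rem mu1 /= /a !exp1n !mul1n -natrM; congr (_%:R).
  have : (0 < count_mem 1%N mu)%N by rewrite -has_count has_pred1.
  by case: (count_mem _ mu) => // c _; rewrite subn1 factS.
by apply: eq_bigr => i _; rewrite count_rem mu1 /= /bump /= add1n subn0.
Qed.

Section Induction.
Variables (m : nat) (F : sf) (phi : 'CF([set: 'S_m])).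
Hypothesis phiE : forall t, phi t = (zee (cycle_type t))%:R * F (cycle_type t).

(** Extends the values of [phi] to a class function on the whole group. On classes without fixed
    points [rem] changes nothing, but there [Ind_cf_lift] multiplies by 0. *)
Let G (s : 'S_m.+1) : algC :=
  (zee (rem 1%N (cycle_type s)))%:R * F (rem 1%N (cycle_type s)).

Lemma mem_Stab (u : 'S_m.+1) : (u \in Stab m) = (u ord_max == ord_max).
Proof. by rewrite !inE /= sub1set !inE. Qed.

Lemma cf_liftE (u : 'S_m.+1) :
  cf_lift phi u = if u ord_max == ord_max then G u else 0.
Proof.
rewrite -mem_Stab; case: ifP => uS; last by rewrite cfun0 ?uS.
pose f s := match [pick t : 'S_m | lift_perm ord_max ord_max t == s] with
    | Some t => phi t | None => 0 end.
have fE s : s \in Stab m -> f s = G s.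
  rewrite mem_Stab /f => /eqP/lift_perm_onto[t0 t0E]; case: pickP => [t /eqP <-|/(_ t0)].
    by rewrite phiE /G -cycle_type_lift.
  by rewrite t0E eqxx.
rewrite /cf_lift cf_of_funE; [exact: fE | | by []].
by move=> y z yS zS; rewrite -!/(f _) !fE ?groupJ // /G cycle_typeJ.
Qed.

Lemma card_to_max (x : 'I_m.+1) : #|[set y : 'S_m.+1 | y x == ord_max]| = #|Stab m|.
Proof.
rewrite -(card_imset _ (mulgI (tperm x ord_max))); apply: eq_card => u.
rewrite mem_Stab; apply/imsetP/eqP => [[y]|ux].
  by rewrite inE => /eqP e ->; rewrite permM tpermR.
exists (tperm x ord_max * u)%g; first by rewrite inE permM tpermL ux.
by rewrite mulgA tperm2 mul1g.
Qed.

(** [s ^ y] fixes [ord_max] exactly when [y] sends some fixed point of [s] there. Each fixed point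
    is served by [#|Stab m|] elements [y], which cancels the normalisation. *)
Lemma Ind_cf_lift (s : 'S_m.+1) : 'Ind[[set: 'S_m.+1]] (cf_lift phi) s =
  (count_mem 1%N (cycle_type s))%:R * G s.
Proof.
rewrite cfIndE ?subsetT //.
have E y : cf_lift phi (s ^ y)%g =
    \sum_(x in [set x | s x == x]) (y x == ord_max)%:R * G s.
  rewrite cf_liftE /G cycle_typeJ -mulr_suml.
  have -> : ((s ^ y)%g ord_max == ord_max) = (s (y^-1%g ord_max) == y^-1%g ord_max).
    by rewrite -{1}[ord_max](permKV y) permJ -(inj_eq (@perm_inj _ y^-1%g)) permK.
  set x0 := y^-1%g ord_max.
  have y0 x : (y x == ord_max) = (x == x0) by rewrite /x0 -{1}(permKV y ord_max) (inj_eq perm_inj).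
  case: ifP => sx.
    rewrite (bigD1 x0) ?inE //= y0 eqxx big1 ?addr0 ?mul1r // => x /andP[_ /negPf ne].
    by rewrite y0 ne.
  rewrite big1 ?mul0r // => x; rewrite inE => /eqP sxx; rewrite y0; case: eqP => // e.
  by rewrite -e sxx eqxx in sx.
rewrite (eq_bigr _ (fun y _ => E y)) exchange_big /=.
rewrite (eq_bigr (fun=> #|Stab m|%:R * G s)) => [|x _].
  rewrite sumr_const -count1_cycle_type; move: (G s) => g.
  by rewrite -(mulr_natl (_ * g)) mulrCA mulKf ?neq0CG.
rewrite -mulr_suml -natr_sum -(card_to_max x) -sum1dep_card big_mkcond /=.
congr (_%:R * _); rewrite [RHS]big_mkcond.
by apply: eq_bigr => y _; rewrite inE; case: ifP.
Qed.
End Induction.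

(** * The characteristic of Lie_n *)

Section NCycle.
Variable n : nat.
Hypothesis n0 : (0 < n)%N.
Local Notation c := (ncycle n).

Lemma ncycleX k (x : 'I_n) : ((c ^+ k)%g x = (x + k) %% n :> nat)%N.
Proof.
rewrite permX; elim: k => [|k IH] /=; first by rewrite addn0 modn_small.
by rewrite permE /= IH -addn1 modnDml addn1 addnS.
Qed.

Lemma ncycleX_fix k (x : 'I_n) : ((c ^+ k)%g x == x) = (n %| k)%N.
Proof.
rewrite -val_eqE /= ncycleX -[X in _ == X](modn_small (ltn_ord x)).
by rewrite -[X in _ == X %[mod n]]addn0 eqn_modDl mod0n.
Qed.

Lemma order_ncycle : #[c]%g = n.
Proof.
apply/eqP; rewrite eqn_dvd order_dvdn; apply/andP; split.
  by apply/eqP/permP => x; apply/eqP; rewrite perm1 ncycleX_fix.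
by rewrite -(ncycleX_fix _ (Ordinal n0)) expg_order perm1.
Qed.

(** [C_n] acts freely, so every orbit of [c ^+ k] is as long as the order of [c ^+ k]. *)
Lemma cycle_type_ncycleX k :
  cycle_type (c ^+ k)%g = nseq (n %/ #[(c ^+ k)%g]%g) #[(c ^+ k)%g]%g.
Proof.
set s := (c ^+ k)%g.
have card_s x : #|porbit s x| = #[s]%g.
  rewrite porbitE card_orbit; suff -> : ('C_<[s]>[x | 'P] = 1)%g by rewrite indexg1.
  apply/trivgP/subsetP => g; rewrite !inE sub1set inE => /andP[/cycleP[i ->] /=].
  by rewrite /aperm -expgM ncycleX_fix -{1}order_ncycle order_dvdn.
have un : {in porbits s, forall X : {set 'I_n}, #|X| = #[s]%g}.
  by move=> _ /imsetP[x _ ->].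
have := card_uniform_partition un (porbits_partition s); rewrite cardsT card_ord => E.
have -> : (n %/ #[s]%g = size (cycle_type s))%N.
  by rewrite [X in (X %/ _)%N]E mulnK ?order_gt0 // size_cycle_type.
apply/all_pred1P; rewrite all_sort all_map; apply/allP => X.
by rewrite mem_enum => /un /= ->.
Qed.

(** The [n] irreducible characters take distinct values at [c], all [n]-th roots of unity. If a
    primitive root were missed, there would be [n.+1] such roots. *)
Lemma prim_lin_char_ncycle : exists i : Iirr <[c]>, n.-primitive_root ('chi_i c).
Proof.
have cyc := cycle_cyclic c; have [z pz] := C_prim_root_exists n0.
have lin (i : Iirr <[c]>) := irr_cyclic_lin i cyc.
have inj : injective (fun i : Iirr <[c]> => 'chi_i c).
  move=> i j e; apply: irr_inj; apply/cfun_inP => _ /cycleP[k ->].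
  by rewrite !lin_charX ?cycle_id // e.
pose rs := [seq 'chi_i c | i <- enum (Iirr <[c]>)].
have urs : all n.-unity_root rs.
  apply/allP => _ /mapP[i _ ->]; apply/unity_rootP.
  by have := lin_char_unity_root (lin i) (cycle_id c); rewrite order_ncycle.
have szrs : size rs = n by rewrite size_map -cardE card_Iirr_cyclic // -[RHS]order_ncycle.
have [/mapP[i _ ez]|nz] := boolP (z \in rs); first by exists i; rewrite -ez.
have := @max_unity_roots _ n (z :: rs) n0; rewrite /= urs nz szrs ltnn.
rewrite map_inj_uniq ?enum_uniq // !andbT => H; suff: false by [].
apply: H => //; by apply/unity_rootP; apply: prim_expr_order.
Qed.

Definition zeta : algC := chi_zeta n c.

Lemma chi_zetaX k : chi_zeta n (c ^+ k)%g = zeta ^+ k.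
Proof.
rewrite /zeta /chi_zeta; case: pickP => [i _|no].
  by rewrite lin_charX ?cycle_id //; apply: irr_cyclic_lin; apply: cycle_cyclic.
by have [i pi] := prim_lin_char_ncycle; rewrite no in pi.
Qed.

Lemma zeta_prim : n.-primitive_root zeta.
Proof.
rewrite /zeta /chi_zeta; case: pickP => [i //|no].
by have [i pi] := prim_lin_char_ncycle; rewrite no in pi.
Qed.


(** Cycle types are conjugation invariant, so each [y] in the induction formula gives the same sum;
    this cancels [n!] and leaves a sum over the cyclic group. *)
Lemma ell_zeta l : ell n l =
  n%:R^-1 * \sum_(k < n) zeta ^+ k * (cycle_type (c ^+ k)%g == l)%:R.
Proof.
rewrite /ell /ch.
have E s : Lie_n n s = n%:R^-1 * \sum_(y : 'S_n) chi_zeta n (s ^ y)%g.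
  rewrite /Lie_n cfIndE ?subsetT // -[#|_|]/(#[c]%g) order_ncycle; congr (_ * _).
  by apply: eq_bigl => y; rewrite inE.
rewrite (eq_bigr _ (fun s _ => E s)) -mulr_sumr mulrCA; congr (_ * _).
rewrite exchange_big /=.
rewrite (eq_bigr (fun=> \sum_(s | cycle_type s == l) chi_zeta n s)) => [|y _]; last first.
  rewrite (reindex_inj (conjg_inj (y^-1)%g)) /=.
  apply: eq_big => s; rewrite ?cycle_typeJ // => _; by rewrite conjgKV.
rewrite sumr_const; set S := \sum_(s | _) _; rewrite -(mulr_natl S) card_Sn mulKf; last first.
  by rewrite pnatr_eq0 -lt0n fact_gt0.
rewrite /S big_mkcond (bigID (fun s => s \in <[c]>%g)) /= [X in _ + X]big1 ?addr0; last first.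
  by move=> s ns; rewrite cfun0 ?if_same.
pose g (k : 'I_n) := (c ^+ k)%g.
have gi : injective g.
  move=> i j /eqP; rewrite eq_expg_mod_order order_ncycle !modn_small // => /eqP.
  exact: val_inj.
rewrite (eq_bigl (fun s => s \in [set g k | k : 'I_n])).
  rewrite big_imset /=; last by move=> ? ? _ _; apply: gi.
  apply: eq_bigr => k _; rewrite /g chi_zetaX.
  by case: ifP; rewrite ?mulr1 ?mulr0.
move=> s; apply/idP/imsetP => [/cyclePmin[i]|[k _ ->]]; last exact: mem_cycle.
by rewrite order_ncycle => lti ->; exists (Ordinal lti).
Qed.

(* The sum of the primitive d-th roots of unity if d divides n. *)
Definition zeta_sum d : algC := \sum_(k < n | #[(c ^+ k)%g]%g == d) zeta ^+ k.

Lemma ell_zeta_sum l : ell n l =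
  n%:R^-1 * \sum_(d <- divisors n) zeta_sum d * (l == nseq (n %/ d) d)%:R.
Proof.
rewrite ell_zeta; congr (_ * _); rewrite /zeta_sum.
under [RHS]eq_bigr do rewrite mulr_suml big_mkcond.
rewrite exchange_big /=; apply: eq_bigr => k _.
have dv : #[(c ^+ k)%g]%g \in divisors n.
  by rewrite -dvdn_divisors // -[X in (_ %| X)%N]order_ncycle orderXdvd.
rewrite (bigD1_seq _ dv) ?divisors_uniq //= eqxx cycle_type_ncycleX eq_sym.
by rewrite big1 ?addr0 // => d; rewrite eq_sym => /negPf ->.
Qed.

(** The elements of order dividing [d] are the powers of [c ^+ (n/d)], so the left side is the sum
    of all [d]-th roots of unity, a geometric sum. *)
Lemma sum_zeta_sum d : (d %| n)%N -> \sum_(e <- divisors d) zeta_sum e = (d == 1%N)%:R.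
Proof.
move=> dn; have d0 := dvdn_gt0 n0 dn.
under eq_bigr do rewrite /zeta_sum big_mkcond.
rewrite exchange_big /=.
transitivity (\sum_(k < n | (n %/ d %| k)%N) zeta ^+ k).
  rewrite [RHS]big_mkcond; apply: eq_bigr => k _.
  have -> : (n %/ d %| k)%N = (#[(c ^+ k)%g]%g %| d)%N.
    by rewrite order_dvdn -expgM -order_dvdn order_ncycle
      -[X in (X %| _ * _)%N](divnK dn) dvdn_pmul2r.
  case: ifP => od.
    rewrite dvdn_divisors // in od; rewrite (bigD1_seq _ od) ?divisors_uniq //= eqxx.
    by rewrite big1 ?addr0 // => e; rewrite eq_sym => /negPf ->.
  rewrite big1_seq // => e /andP[_]; case: eqP => // <-.
  by rewrite -dvdn_divisors // od.
set q := (n %/ d)%N; have q0 : (0 < q)%N by rewrite divn_gt0 // dvdn_leq.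
have -> : \sum_(k < n | (q %| k)%N) zeta ^+ k = \sum_(i < d) (zeta ^+ q) ^+ i.
  have lt (i : 'I_d) : (q * i < n)%N by rewrite -[X in (_ < X)%N](divnK dn) ltn_pmul2l.
  pose g (i : 'I_d) := Ordinal (lt i).
  have gi : injective g.
    by move=> i j /(congr1 val)/eqP /=; rewrite eqn_pmul2l // => /eqP/val_inj.
  rewrite (eq_bigl (fun s => s \in [set g k | k : 'I_d])).
    rewrite big_imset /=; last by move=> ? ? _ _; apply: gi.
    by apply: eq_bigr => i _; rewrite exprM.
  move=> k; apply/idP/imsetP => [/dvdnP[i ki]|[i _ ->]]; last by rewrite /= dvdn_mulr.
  have lti : (i < d)%N by rewrite -(ltn_pmul2r q0) -ki mulnC divnK.
  by exists (Ordinal lti) => //; apply: val_inj; rewrite /= ki mulnC.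
have pq : d.-primitive_root (zeta ^+ q).
  exact: (dvdn_prim_root zeta_prim dn).
case: eqP => [d1|d1]; first by move: pq; rewrite d1 big_ord1.
have := subrX1 (zeta ^+ q) d; rewrite (prim_expr_order pq) subrr => /esym/eqP.
rewrite mulf_eq0 subr_eq0 => /orP[/eqP e|/eqP //].
by case: d1; have := prim_order_dvd pq 1; rewrite expr1 e eqxx dvdn1 => /eqP.
Qed.
End NCycle.

(** * The Mobius function *)

Lemma eq_divisor_sums (f g : nat -> algC) n : (0 < n)%N ->
  (forall d, (d %| n)%N -> \sum_(e <- divisors d) f e = \sum_(e <- divisors d) g e) ->
  f n = g n.
Proof.
elim/ltn_ind: n => n IH n0 fg; have := fg n (dvdnn n).
rewrite !(bigD1_seq n) ?divisors_uniq ?divisors_id //=.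
rewrite big_seq_cond [in X in _ = X]big_seq_cond.
rewrite (eq_bigr g) => [|e]; first exact: addIr.
rewrite -dvdn_divisors // => /andP[en /eqP ne]; have e0 := dvdn_gt0 n0 en.
apply: IH => // [|d de]; last by apply: fg; apply: dvdn_trans de en.
by rewrite ltn_neqAle dvdn_leq // andbT; apply/eqP.
Qed.

(** Computed inside [C_d] itself, so that no [n] enters. *)
Definition mobius d : algC := zeta_sum d d.

(** The roots [zeta n] and [zeta d] are chosen separately; equal sums over all divisors force the
    two values to agree. *)
Lemma zeta_sum_mobius n d : (0 < n)%N -> (d %| n)%N -> zeta_sum n d = mobius d.
Proof.
move=> n0 dn; have d0 := dvdn_gt0 n0 dn.
apply: (@eq_divisor_sums (zeta_sum n) (zeta_sum d)) => // e ed.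
by rewrite (sum_zeta_sum d0) // (sum_zeta_sum n0) // (dvdn_trans ed).
Qed.

Lemma sum_mobius n : (0 < n)%N -> \sum_(d <- divisors n) mobius d = (n == 1%N)%:R.
Proof.
move=> n0; rewrite -(sum_zeta_sum n0) // !big_seq; apply: eq_bigr => d.
by rewrite -dvdn_divisors // => dn; rewrite zeta_sum_mobius.
Qed.

Lemma ellE n l : (0 < n)%N ->
  ell n l = n%:R^-1 * \sum_(d <- divisors n) mobius d * (l == nseq (n %/ d) d)%:R.
Proof.
move=> n0; rewrite ell_zeta_sum //; congr (_ * _); rewrite !big_seq.
apply: eq_bigr => d; rewrite -dvdn_divisors // => dn.
by rewrite zeta_sum_mobius.
Qed.

(** * The recurrences *)

Lemma sum_rank_part (V : nmodType) n (f : seq nat -> V) :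
  \sum_(i < n.+1) \sum_(lam <- partitions n | (1%N \notin lam) && (rank_part lam == i)) f lam
  = \sum_(lam <- partitions n | 1%N \notin lam) f lam.
Proof.
rewrite (exchange_big_dep (fun lam : seq nat => 1%N \notin lam)) /=; last by move=> i lam _ /andP[].
rewrite big_seq_cond [RHS]big_seq_cond; apply: eq_bigr => lam /andP[lamn lam1].
have [_ sl _] := bpartsP lamn.
have lt : (rank_part lam < n.+1)%N by rewrite ltnS /rank_part sl leq_subr.
rewrite lam1 (big_pred1 (Ordinal lt)) // => i.
by apply/eqP/eqP => [e|-> //]; apply: val_inj.
Qed.

Lemma coef_psum1M N (P : {mpoly algC[N]}) (mu : seq nat) : part_le N mu ->
  (psum N 1 * P)@_(mexp N mu) =
  if 1%N \in mu then P@_(mexp N (rem 1%N mu)) else 0.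
Proof.
move=> gl; case: ifP => mu1.
  rewrite (mexp_perm _ (perm_to_rem mu1)) -cat1s mexp_cat /psum.
  have /andP[/allP/(_ _ mu1)/= -> _] := gl.
  by rewrite mulrC addmC [(_ + mexp _ [:: _])%MM]addmC mcoeffMX.
rewrite /psum; case: ifP => N1; last by rewrite mul0r mcoeff0.
rewrite mcoeffM big1 // => -[k1 k2] /= /eqP e; rewrite mcoeffX.
case: eqP => [e1|]; last by rewrite mul0r.
have /mnmP/(_ (Ordinal N1)) := e; rewrite -e1 mnmDE !mnmE /= addn0.
have -> : count_mem 1%N mu = 0%N by apply/count_memPn; rewrite mu1.
by [].
Qed.

Lemma eq_expsum (F : numFieldType) (R : comAlgType F) (x y : nat -> R) n :
  x =1 y -> expsum x n = expsum y n.
Proof.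
by move=> xy; apply: eq_bigr => mu _; apply: eq_bigr => j _; rewrite xy.
Qed.

Lemma signr_scale (k : nat) (A : algType algC) (x : A) : (-1) ^+ k * x = ((-1) ^+ k : algC) *: x.
Proof.
rewrite -signr_odd -[in RHS]signr_odd.
by case: (odd k); rewrite ?expr0 ?expr1 ?scaleN1r ?mulN1r ?scale1r ?mul1r.
Qed.

Lemma zee_gt0 l : all (leq 1) l -> (0 < zee l)%N.
Proof.
move=> al; rewrite /zee big_seq; apply: prodn_cond_gt0 => i; rewrite mem_undup => il.
by rewrite muln_gt0 fact_gt0 expn_gt0 (allP al).
Qed.

(** Carries a recurrence for polynomials over to characters: multiplication by [p_1] becomes
    induction. The [m.+1] variables cover every cycle type in both groups. *)
Lemma recurrence_transfer m (H : forall n, 'CF([set: 'S_n]))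
    (L : nat -> {mpoly algC[m.+1]}) (D : {mpoly algC[m.+1]}) (delta : 'CF([set: 'S_m.+1])) :
  (forall n (s : 'S_n), (n <= m.+1)%N ->
     H n s = (zee (cycle_type s))%:R * (L n)@_(mexp m.+1 (cycle_type s))) ->
  L m.+1 = psum m.+1 1 * L m + (-1) ^+ m.+1 * D ->
  (forall s, delta s = (zee (cycle_type s))%:R * D@_(mexp m.+1 (cycle_type s))) ->
  H m.+1 = 'Ind[[set: 'S_m.+1]] (cf_lift (H m)) + (-1) ^+ m.+1 *: delta.
Proof.
move=> HE LE dE; apply/cfunP => s; rewrite HE // LE !cfunE.
rewrite (Ind_cf_lift (F := fun l => (L m)@_(mexp m.+1 l))) => [|t]; last by rewrite HE.
have gs := part_le_cycle_type s (leqnn m.+1).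
rewrite mcoeffD mulrDr signr_scale mcoeffZ dE mulrCA coef_psum1M //; congr (_ + _).
(* Without fixed points both the induced value and the coefficient vanish; otherwise [zee_rem1]
   matches them. *)
case: ifP => s1; last first.
  by rewrite mulr0 (count_memPn _) ?mul0r // s1.
rewrite mulrA -natrM -zee_rem1 //.
by have /andP[+ _] := gs; apply: sub_all => i /andP[].
Qed.

Lemma sum_chinvE N n (SF : seq nat -> sf) (P : seq nat -> {mpoly algC[N]}) (s : 'S_n) :
  (n <= N)%N -> {in partitions n, forall lam, rep (SF lam) (P lam)} ->
  (\sum_(i < n.+1)
     \sum_(lam <- partitions n | (1%N \notin lam) && (rank_part lam == i))
        chinv n (SF lam)) s =
  (zee (cycle_type s))%:R *
  (\sum_(lam <- partitions n | 1%N \notin lam) P lam)@_(mexp N (cycle_type s)).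
Proof.
move=> nN SP; rewrite sum_rank_part sum_cfunE.
rewrite (eq_bigr _ (fun lam _ => chinvE (SF lam) s)) -mulr_sumr; congr (_ * _).
rewrite -big_filter -[in RHS]big_filter.
apply: (@rep_sum N _ _ SF P) (part_le_cycle_type s nN) => lam.
by rewrite mem_filter => /andP[_ /SP].
Qed.

(** Reads off character values: [c_i = 1] gives the trivial character and [c_i = (-1)^(i-1)] the
    sign. *)
Lemma zee_coef_expsum N n (c : nat -> algC) (s : 'S_n) : (n <= N)%N ->
  (zee (cycle_type s))%:R *
    (expsum (fun i => c i *: psum N i) n)@_(mexp N (cycle_type s)) =
  \prod_(i <- cycle_type s) c i.
Proof.
move=> nN; have gs := part_le_cycle_type s nN.
rewrite coef_expsum ?sumn_cycle_type // mulVKf // pnatr_eq0 -lt0n zee_gt0 //.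
by have /andP[+ _] := gs; apply: sub_all => i /andP[].
Qed.

Lemma tauE m (s : 'S_m.+1) : tau m.+1 s = (zee (cycle_type s))%:R *
  (eseq (psum m.+1) m.+1 + (if m is k.+1 then psum m.+1 2 * eseq (psum m.+1) k else 0))@_
    (mexp m.+1 (cycle_type s)).
Proof.
have gs := part_le_cycle_type s (leqnn m.+1).
rewrite /tau ltnS; case: leqP => m3.
  rewrite -(hseq_small (psum m.+1) m3) (eq_expsum _ (fun i => esym (scale1r (psum m.+1 i)))).
  by rewrite zee_coef_expsum // big1 // cfun1E inE.
case: m s m3 gs => [|[|[|k]]] // s _ gs; set N := k.+4.
rewrite !cfunE /chi_part !chinvE -mulrBr; congr (_ * _).
(* The matrix sizes agree only up to [size_nseq], so the determinant is transported along an
   equality of sizes. *)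
have det_size K (f : nat -> nat -> {mpoly algC[N]}) K' : K = K' ->
    \det (\matrix_(i < K, j < K) f i j) = \det (\matrix_(i < K', j < K') f i j).
  by move=> ->.
rewrite -(det_hook_sub_double (psum N) k) mcoeffB; congr (_ - _).
  rewrite (@rep_schur N) //.
  rewrite (det_size _ (fun i j => if (nth 0 (3 :: nseq k.+1 1) i + j < i)%N then 0
     else expsum (psum N) (nth 0 (3 :: nseq k.+1 1) i + j - i)%N) k.+2) /=;
    last by rewrite size_nseq.
  congr ((\det _)@_ _); apply/matrixP => -[[|i] lti] j; rewrite !mxE.
    by rewrite /= subn0.
  have -> : nth 0%N (3 :: nseq k.+1 1)%N i.+1 = 1%N by rewrite [LHS](nth_nseq 0%N k.+1) ifT.
  by [].
have -> : (N - 4 = k)%N by rewrite /N -addn4 addnK.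
rewrite (@rep_schur N) //.
rewrite (det_size _ (fun i j => if (nth 0 [:: 2, 2 & nseq k 1] i + j < i)%N then 0
     else expsum (psum N) (nth 0 [:: 2, 2 & nseq k 1] i + j - i)%N) k.+2) /=;
    last by rewrite size_nseq.
congr ((\det _)@_ _); apply/matrixP => -[[|[|i]] lti] j; rewrite !mxE.
- by rewrite /= subn0.
- by rewrite /= subn1.
have -> : nth 0%N [:: 2, 2 & nseq k 1]%N i.+2 = 1%N by rewrite [LHS](nth_nseq 0%N k) ifT.
by [].
Qed.

Theorem theorem1p2 (m : nat) :
  LieHat m.+1 = 'Ind[[set: 'S_m.+1]] (cf_lift (LieHat m)) + (-1) ^+ m.+1 *: sign_cf m.+1
  /\ WHat m.+1 = 'Ind[[set: 'S_m.+1]] (cf_lift (WHat m)) + (-1) ^+ m.+1 *: tau m.+1.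
Proof.
split.
  pose L n := \sum_(lam <- partitions n | 1%N \notin lam)
    \prod_(j <- undup lam) expsum (pk_ell (psum m.+1) mobius j) (count_mem j lam).
  apply: (recurrence_transfer (H := LieHat) (L := L) (D := eseq (psum m.+1) m.+1)).
  - by move=> n s nm; apply: sum_chinvE => // lam; apply: rep_LieSF; apply: ellE.
  - apply: (lie_hat_rec sum_mobius
      (a := fun j => expsum (pk_ell (psum m.+1) mobius j))) => // j _; apply: newton_expsum.
  (* [e_n] has the scalars [(-1)^(i-1)], whose product over the cycles is the sign. *)
  move=> s; rewrite /eseq (eq_expsum _ (fun i => signr_scale i.-1 (psum _ i))).
  rewrite zee_coef_expsum // sign_cfE odd_perm_cycle_type prod_sign_pred ?sumn_cycle_type //.
  by have /andP[+ _] := part_le_cycle_type s (leqnn m.+1); apply: sub_all => i /andP[].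
pose L n := \sum_(lam <- partitions n | 1%N \notin lam)
  \prod_(j <- undup lam) expsum (pk_W (psum m.+1) mobius j) (count_mem j lam).
apply: (recurrence_transfer (H := WHat) (L := L)) (@tauE m).
- by move=> n s nm; apply: sum_chinvE => // lam; apply: rep_WSF; apply: ellE.
- apply: (w_hat_rec sum_mobius
    (a := fun j => expsum (pk_W (psum m.+1) mobius j))) => // j _; apply: newton_expsum.
Qed.
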